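(* There exists a constant $c>0$ such that the following holds for every large enough integer $n$. In the $(1:1)$ Waiter-Client game played on the edge set of $K_n$, Waiter has a strategy to force Client to claim a graph which contains a copy of every tree $T$ with $n$ vertices and maximum degree $\Delta(T)\leq \frac{cn}{\log(n)}$.
   Context: In the $(1:1)$ Waiter-Client game on $K_n$, in each round Waiter offers two previously unoffered edges of $K_n$ to Client; Client chooses one of them for himself and the other goes to Waiter; if in the last round only one edge remains, it goes to Waiter. Client's graph is the spanning subgraph of $K_n$ formed by the edges Client chose. $\log$ denotes the natural logarithm. *)

(* Defs.v *)
From mathcomp Require Import all_boot.

Set Implicit Arguments.
Unset Strict Implicit.
Unset Printing Implicit Defensive.

Section WaiterClient.
Variables (E : finType) (X : {set E}).

(* A history lists the rounds played so far, most recent first; a round is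
   recorded as (element chosen by Client, element that went to Waiter). *)
Definition history := seq (E * E).

Definition offered (h : history) : {set E} :=
  [set e | (e \in unzip1 h) || (e \in unzip2 h)].

Definition unoffered (h : history) : {set E} := X :\: offered h.

Definition client_set (h : history) : {set E} := [set e in unzip1 h].

(* The two components of the pair are the two elements Waiter offers. *)
Definition waiter_strategy := history -> E * E.

(* The histories that can arise when Waiter follows [S] and Client chooses
   arbitrarily. A round takes place only while two elements are unoffered;
   a single leftover element goes to Waiter, so it never enters
   [client_set]. *)
Inductive play (S : waiter_strategy) : history -> Prop :=
| play_start : play S [::]
| play_fst h : play S h -> 1 < #|unoffered h| ->
    play S (((S h).1, (S h).2) :: h)
| play_snd h : play S h -> 1 < #|unoffered h| ->
    play S (((S h).2, (S h).1) :: h).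

Definition legal (S : waiter_strategy) : Prop :=
  forall h, play S h -> 1 < #|unoffered h| ->
    [/\ (S h).1 \in unoffered h, (S h).2 \in unoffered h & (S h).1 != (S h).2].

Definition waiter_forces (P : {set E} -> Prop) : Prop :=
  exists S : waiter_strategy, legal S /\
    forall h, play S h -> #|unoffered h| <= 1 -> P (client_set h).

End WaiterClient.

Definition complete_edges (n : nat) : {set {set 'I_n}} :=
  [set e : {set 'I_n} | #|e| == 2].

Definition graph_of (n : nat) (C : {set {set 'I_n}}) : rel 'I_n :=
  fun x y => (x != y) && ([set x; y] \in C).

Section Trees.
Variables (V : finType) (T : rel V).

Definition simple_graph : Prop := symmetric T /\ irreflexive T.

Definition connected_graph : Prop := 0 < #|V| /\ forall x y, connect T x y.

(* [ucycle] also accepts the empty sequence, single loops and the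
   back-and-forth walk along one edge, hence the bound on the size. *)
Definition acyclic_graph : Prop :=
  forall p : seq V, 2 < size p -> ~ ucycle T p.

Definition is_tree : Prop :=
  [/\ simple_graph, connected_graph & acyclic_graph].

Definition max_degree : nat := \max_(x : V) #|[set y | T x y]|.

End Trees.

(* Not necessarily induced. *)
Definition contains_copy (V W : finType) (G : rel W) (T : rel V) : Prop :=
  exists f : V -> W, injective f /\ forall x y, T x y -> G (f x) (f y).

(* Main.v *)
(** Client's graph is made pseudo-random, and a spanning tree is then embedded
    greedily up to an independent set [I] of vertices of degree at most two.

    Game. Waiter keeps a sum of products of factors [1 - y_wa y_wb / 2] from
    increasing too much, where [y_e] is 1, 0 or 1/2 for an edge owned by Client,
    owned by Waiter, or unoffered. The edges are split into few boards so that
    [wa] and [wb] are almost never on the same board; the mixed differences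
    inside a board are then nonnegative, and offering the two edges of a board
    with the closest derivatives multiplies the sum by at most [1 + 2 / (r - 1)]
    when [r] edges of the board are left. Hence any two vertices have linearly
    many common neighbours in a fixed set [S], and for any [K] disjoint pairs all
    but few vertices are adjacent to both members of one of the pairs.

    Embedding. Root the tree and embed the vertices outside [I] top-down.
    The neighbours of a small part [I1] of [I] go into [S], derandomized with an
    exponential potential so that every vertex [w] of the host can later be the
    image of a positive proportion of [I1]; this is where the maximum degree
    [c n / log n] is needed. The other vertices avoid [S] whenever possible; a
    vertex all of whose neighbours outside [S] are used up stays so, so there are
    fewer than [2 K] of them and [S] hardly fills up. Finally [I] is placed by a
    bijection with the most well-placed vertices: a misplaced vertex could be
    repaired by a 3-cycle. *)

Require Import Defs.
From mathcomp Require Import all_boot all_order all_algebra.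
From mathcomp Require Import reals exp.
From mathcomp Require Import perm finfield sequences.
From mathcomp Require Import lra zify ring.

Set Implicit Arguments.
Unset Strict Implicit.
Unset Printing Implicit Defensive.

Import Order.TTheory GRing.Theory Num.Theory.
Local Open Scope ring_scope.

(** * Potentials on partially decided edge sets *)

Section Potential.
Variables (R : realFieldType) (E B : finType) (col : E -> B).
Implicit Types (y : {ffun E -> R}) (e f : E).

Definition upd y e (s : R) : {ffun E -> R} :=
  [ffun z => if z == e then s else y z].

Lemma upd_comm y e f (s t : R) : e != f ->
  upd (upd y e s) f t = upd (upd y f t) e s.
Proof.
move=> ef; apply/ffunP => z; rewrite !ffunE.
by case: (eqVneq z f) => // ->; rewrite eq_sym (negbTE ef).
Qed.

Lemma upd_id y e : upd y e (y e) = y.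
Proof. by apply/ffunP => z; rewrite !ffunE; case: eqVneq => // ->. Qed.

Definition in_cube y := forall e, 0 <= y e <= 1.

Lemma in_cube_upd y e (s : R) : in_cube y -> 0 <= s <= 1 -> in_cube (upd y e s).
Proof. by move=> yC sC z; rewrite ffunE; case: ifP. Qed.

(** An edge only ever takes the values 0, 1/2 and 1, so affinity is stated at the midpoint. *)
Definition affine_in (g : {ffun E -> R} -> R) := forall y e,
  g (upd y e 0) + g (upd y e 1) = 2 * g (upd y e 2^-1).

Definition decreasing_in (g : {ffun E -> R} -> R) := forall y e,
  in_cube y -> g (upd y e 1) <= g (upd y e 0).

(** The mixed difference in two edges of one board is nonnegative. Together with affinity this makes
    the average of [g] over the two outcomes of offering them at most its present value. *)
Definition board_supermodular (g : {ffun E -> R} -> R) := forall y e f,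
  in_cube y -> e != f -> col e = col f ->
  g (upd (upd y e 1) f 0) + g (upd (upd y e 0) f 1)
  <= g (upd (upd y e 0) f 0) + g (upd (upd y e 1) f 1).

Record potential (g : {ffun E -> R} -> R) : Prop := Potential {
  pot_ge0 : forall y, in_cube y -> 0 <= g y;
  pot_affine : affine_in g;
  pot_decr : decreasing_in g;
  pot_super : board_supermodular g }.

Definition independent_of (g : {ffun E -> R} -> R) e :=
  forall y (s : R), g (upd y e s) = g y.

Lemma potential_const (c : R) : 0 <= c -> potential (fun=> c).
Proof.
by move=> c0; split=> // y *; lra.
Qed.

Lemma potential_add g h : potential g -> potential h ->
  potential (fun y => g y + h y).
Proof.
move=> [g0 ga gd gs] [h0 ha hd hs]; split.
- by move=> y yC; rewrite addr_ge0 ?g0 ?h0.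
- by move=> y e; move: (ga y e) (ha y e); lra.
- by move=> y e yC; move: (gd y e yC) (hd y e yC); lra.
- by move=> y e f yC ef cef; move: (gs y e f yC ef cef) (hs y e f yC ef cef); lra.
Qed.

Lemma potential_scale (c : R) g : 0 <= c -> potential g ->
  potential (fun y => c * g y).
Proof.
move=> c0 [g0 ga gd gs]; split.
- by move=> y yC; rewrite mulr_ge0 ?g0.
- by move=> y e; rewrite -mulrDr ga mulrCA.
- by move=> y e yC; rewrite ler_wpM2l ?gd.
- by move=> y e f yC ef cef; rewrite -!mulrDr ler_wpM2l ?gs.
Qed.

Lemma potential_sum (J : finType) (P : pred J) (g : J -> {ffun E -> R} -> R) :
  (forall j, P j -> potential (g j)) ->
  potential (fun y => \sum_(j | P j) g j y).
Proof.
move=> gP; split.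
- by move=> y yC; apply: sumr_ge0 => j /gP gj; apply: pot_ge0.
- move=> y e; rewrite -big_split mulr_sumr /=.
  by apply: eq_bigr => j /gP gj; apply: pot_affine.
- by move=> y e yC; apply: ler_sum => j /gP gj; apply: pot_decr.
- move=> y e f yC ef cef; rewrite -!big_split.
  by apply: ler_sum => j /gP gj; apply: pot_super.
Qed.

(* If [e] and [f] lie in different factors, the mixed difference of the
   product is a product of two nonpositive differences. *)
Lemma potential_mul g h : potential g -> potential h ->
  (forall e, independent_of g e \/ independent_of h e) ->
  potential (fun y => g y * h y).
Proof.
move=> [g0 ga gd gs] [h0 ha hd hs] gh.
have c01 : 0 <= (0 : R) <= 1 by lra.
have c11 : 0 <= (1 : R) <= 1 by lra.
split.
- by move=> y yC; rewrite mulr_ge0 ?g0 ?h0.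
- move=> y e; case: (gh e) => i.
    by rewrite !i -mulrDr ha mulrCA.
  by rewrite !i -mulrDl ga mulrA.
- move=> y e yC; case: (gh e) => i.
    by rewrite !i ler_wpM2l ?g0 ?hd.
  by rewrite !i ler_wpM2r ?h0 ?gd.
- move=> y e f yC ef cef; case: (gh e) => ie; case: (gh f) => jf.
  + by rewrite !(jf, ie) -!mulrDr ler_wpM2l ?g0 ?hs.
  + have G s t : g (upd (upd y e s) f t) = g (upd y f t) by rewrite upd_comm // ie.
    rewrite !G !jf; have := gd y f yC; have := hd y e yC; nra.
  + have H s t : h (upd (upd y e s) f t) = h (upd y f t) by rewrite upd_comm // ie.
    rewrite !H !jf; have := gd y e yC; have := hd y f yC; nra.
  + by rewrite !(jf, ie) -!mulrDl ler_wpM2r ?h0 ?gs.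
Qed.

End Potential.

(** * Products of factors over disjoint pairs of edges *)

Section Factors.
Variables (R : realFieldType) (E B : finType) (col : E -> B).
Implicit Types (y : {ffun E -> R}) (e f : E).

(** Worth 1/2 when Client owns both edges, 1 when Waiter owns one of them, and 7/8 before the
    game. *)
Definition both_factor (p : E * E) y : R := 1 - y p.1 * y p.2 / 2.

Lemma both_factor_indep (p : E * E) e :
  e != p.1 -> e != p.2 -> independent_of (both_factor p) e.
Proof.
by move=> n1 n2 y s; rewrite /both_factor !ffunE !(eq_sym _ e) (negbTE n1) (negbTE n2).
Qed.

Lemma potential_both_factor (p : E * E) :
  col p.1 != col p.2 -> potential col (both_factor p).
Proof.
case: p => a b /= cab.
have ab : a != b by apply: contraNneq cab => ->.
rewrite /both_factor; split => /=.
- by move=> y yC; have := yC a; have := yC b; nra.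
- move=> y e; rewrite !ffunE.
  case: (eqVneq a e) => [ae|_]; last by case: eqP => _; lra.
  by rewrite -ae eq_sym (negbTE ab); lra.
- move=> y e yC; rewrite !ffunE; have := yC a; have := yC b.
  case: (eqVneq a e) => [ae|_]; last by case: eqP => _; nra.
  by rewrite -ae eq_sym (negbTE ab); nra.
- move=> y e f yC ef cef; rewrite !ffunE.
  have nef : ~~ ((a == e) && (b == f)).
    by apply: contra cab => /andP[/eqP-> /eqP->]; rewrite cef.
  have nfe : ~~ ((a == f) && (b == e)).
    by apply: contra cab => /andP[/eqP-> /eqP->]; rewrite cef.
  have two (x z : E) : x != z -> forall u : E, ~~ ((u == x) && (u == z)).
    by move=> xz u; apply: contra xz => /andP[/eqP<- /eqP<-].
  have := two _ _ ab e; have := two _ _ ab f; have := two _ _ ef a; have := two _ _ ef b.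
  rewrite !(eq_sym e) !(eq_sym f); move: nef nfe; have := yC a; have := yC b.
  case: (a == e); case: (b == e); case: (a == f); case: (b == f) => //=; nra.
Qed.

Definition edge_disjoint (L : seq (E * E)) : Prop :=
  {in L &, forall p q, (p.1 \in [:: q.1; q.2]) || (p.2 \in [:: q.1; q.2]) -> p = q}.

Lemma potential_prod (L : seq (E * E)) : uniq L -> edge_disjoint L ->
  (forall p, p \in L -> col p.1 != col p.2) ->
  potential col (fun y => \prod_(p <- L) both_factor p y).
Proof.
move=> Lu Ld Lc.
(* The induction also carries that the product ignores every edge outside [L]; this is the
   independence that [potential_mul] asks for. *)
suff [] : potential col (fun y => \prod_(p <- L) both_factor p y) /\
  (forall e, (forall p, p \in L -> e \notin [:: p.1; p.2]) ->
     independent_of (fun y => \prod_(p <- L) both_factor p y) e) by [].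
elim: L Lu Ld Lc => [|p L IH] /=.
  split=> [|e _ y s]; last by rewrite !big_nil.
  have -> : (fun y => \prod_(p <- [::]) both_factor p y) = (fun=> 1).
    by apply: boolp.funext => y; rewrite big_nil.
  by apply: potential_const; lra.
case/andP=> pL Lu Ld Lc.
have [||| gP gI] := IH => //.
- by move=> a b aL bL; apply: Ld; rewrite inE ?aL ?bL orbT.
- by move=> a aL; apply: Lc; rewrite inE aL orbT.
have -> : (fun y => \prod_(q <- p :: L) both_factor q y) =
  (fun y => both_factor p y * \prod_(q <- L) both_factor q y).
  by apply: boolp.funext => y; rewrite big_cons.
split.
  apply: potential_mul => //.
    by apply: potential_both_factor; apply: Lc; rewrite inE eqxx.
  move=> e; case: (boolP (e \in [:: p.1; p.2])) => ep; last first.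
    left; move: ep; rewrite !inE negb_or => /andP[e1 e2].
    exact: both_factor_indep.
  right; apply: gI => q qL; apply: contra pL => eq.
  suff -> : p = q by [].
  apply: Ld; rewrite ?inE ?eqxx ?qL ?orbT //; move: ep eq; rewrite !inE.
  by case/orP=> /eqP -> ->; rewrite ?orbT.
move=> e eL y s; rewrite gI; last by move=> q qL; apply: eL; rewrite inE qL orbT.
have := eL p; rewrite !inE eqxx => /(_ isT); rewrite negb_or => /andP[e1 e2].
by rewrite both_factor_indep.
Qed.

End Factors.

(** Pigeonhole: gaps all larger than [2 * G / r], with [r = #|U| - 1], would spread the values over
    more than the length [2 * G] of their range. *)
Lemma close_values (R : realFieldType) (E : finType) (U : {set E}) (d : E -> R) (G : R) :
  (1 < #|U|)%N -> {in U, forall e, - G <= d e <= G} ->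
  exists e f, [/\ e \in U, f \in U, e != f & `|d e - d f| * (#|U|.-1)%:R <= 2 * G].
Proof.
move=> U1 dG; set r := #|U|.-1.
have r0 : 0 < r%:R :> R by rewrite ltr0n /r; lia.
case: (boolP [exists e in U, exists f in U, (e != f) && (`|d e - d f| * r%:R <= 2 * G)]).
  by case/exists_inP=> e eU /exists_inP[f fU /andP[ef H]]; exists e, f.
move=> /exists_inPn Hn; exfalso.
have sep e f : e \in U -> f \in U -> e != f -> 2 * G < `|d e - d f| * r%:R.
  by move=> eU fU ef; have := Hn e eU => /exists_inPn/(_ f fU); rewrite ef /= -ltNge.
(* Induction by removing a maximum [b]: the maximum [c] of the rest lies more than [2 * G / r] below
   it. *)
have spread k : forall W : {set E}, W \subset U -> #|W| = k.+1 ->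
    exists a b, [/\ a \in W, b \in W, {in W, forall z, d z <= d b},
      k%:R * (2 * G) <= (d b - d a) * r%:R &
      (0 < k)%N -> k%:R * (2 * G) < (d b - d a) * r%:R].
  elim: k => [|k IH] W WU cW.
    move/eqP: cW => /cards1P[a ->]; exists a, a; rewrite !inE eqxx; split=> //.
      by move=> z; rewrite inE => /eqP ->.
    by rewrite mul0r subrr mul0r.
  have [b0 b0W] : exists b, b \in W by apply/set0Pn; rewrite -card_gt0 cW.
  have [b bW bmax] : exists2 b, b \in W & {in W, forall z, d z <= d b}.
    by case: (Order.TotalTheory.arg_maxP d b0W) => b bW H; exists b.
  have [||a [c [aW cW' cmax H]]] := IH (W :\ b).
  - by apply: subset_trans WU; rewrite subsetDl.
  - by move: (cardsD1 b W); rewrite bW cW; lia.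
  move: aW cW'; rewrite !inE => /andP[ab aW] /andP[cb cW'].
  exists a, b.
  have := sep b c (subsetP WU _ bW) (subsetP WU _ cW'); rewrite eq_sym cb => /(_ isT).
  have := bmax c cW'; rewrite -subr_ge0 => h; rewrite ger0_norm //.
  move=> h'; have Hs : k.+1%:R * (2 * G) < (d b - d a) * r%:R by rewrite -natr1; lra.
  by split=> //; apply: ltW.
have rp : (0 < r)%N by rewrite /r; lia.
have [|a [b [aU bU _ _]]] := spread r U (subxx _); first by rewrite /r; lia.
move/(_ rp); have := dG a aU; have := dG b bU => h1 h2.
have : (d b - d a) * r%:R <= (2 * G) * r%:R by rewrite ler_pM2r //; lra.
by lra.
Qed.

(** * The potential argument for Waiter *)

Section Game.
Variables (R : realFieldType) (E B : finType) (col : E -> B) (X : {set E}).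
Implicit Types (h : history E) (e f : E).

Lemma prodr_natS_ge1 (J : finType) (P : pred J) (r : J -> nat) :
  1 <= \prod_(j | P j) (r j).+1%:R :> R.
Proof. by rewrite -natr_prod ler1n prodn_gt0. Qed.

Lemma waiter_forces_monovariant (e0 : E) (Psi : history E -> R) :
  (forall h, (1 < #|unoffered X h|)%N -> exists e f,
     [/\ e \in unoffered X h, f \in unoffered X h, e != f &
       Psi ((e, f) :: h) <= Psi h /\ Psi ((f, e) :: h) <= Psi h]) ->
  exists S, legal X S /\ forall h, play X S h -> Psi h <= Psi [::].
Proof.
move=> step.
pose ok h (p : E * E) := [&& p.1 \in unoffered X h, p.2 \in unoffered X h, p.1 != p.2,
  Psi ((p.1, p.2) :: h) <= Psi h & Psi ((p.2, p.1) :: h) <= Psi h].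
(* The default [(e0, e0)] is reached only when at most one edge is unoffered, and then no round is
   played. *)
pose S h := odflt (e0, e0) [pick p | ok h p].
have SP h : (1 < #|unoffered X h|)%N -> ok h (S h).
  move=> /step[e [f [eU fU ef [H1 H2]]]]; rewrite /S; case: pickP => //= /(_ (e, f)).
  by rewrite /ok /= eU fU ef H1 H2.
exists S; split=> [h _ /SP|h]; first by case/and5P=> ? ? ? _ _; split.
elim=> {h} // h _ IH /SP /and5P[_ _ _ H1 H2]; exact: le_trans IH.
Qed.

Definition state h : {ffun E -> R} :=
  [ffun e => if e \in unzip1 h then 1 else if e \in unzip2 h then 0 else 2^-1].

Lemma state_cube h : in_cube (state h).
Proof. by move=> e; rewrite ffunE; case: ifP => _; [|case: ifP => _]; lra. Qed.

Lemma unofferedE h e :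
  (e \in unoffered X h) = [&& e \notin unzip1 h, e \notin unzip2 h & e \in X].
Proof. by rewrite !inE negb_or -andbA. Qed.

Lemma state_unoffered h e : e \in unoffered X h -> state h e = 2^-1.
Proof. by rewrite unofferedE ffunE => /and3P[/negbTE-> /negbTE-> _]. Qed.

Lemma state_cons h e f : e \in unoffered X h -> f \in unoffered X h -> e != f ->
  state ((e, f) :: h) = upd (upd (state h) e 1) f 0.
Proof.
rewrite !unofferedE => /and3P[e1 e2 _] /and3P[f1 f2 _] ef; apply/ffunP => z.
rewrite !ffunE !inE; case: (eqVneq z f) => [->|_] /=.
  by rewrite eq_sym (negbTE ef) (negbTE f1).
by case: (eqVneq z e).
Qed.

Lemma unoffered_cons h e f : unoffered X ((e, f) :: h) = unoffered X h :\ e :\ f.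
Proof.
by apply/setP => z; rewrite !inE; case: (z == e); case: (z == f); rewrite ?orbT ?andbF //=.
Qed.

Definition board h b := [set e in unoffered X h | col e == b].

Lemma mem_board h e b :
  (e \in board h b) = (e \in unoffered X h) && (col e == b).
Proof. by rewrite in_set. Qed.

Definition weight h : R := \prod_b (#|board h b|.+1)%:R.

Lemma board_consC h e f b : board ((e, f) :: h) b = board ((f, e) :: h) b.
Proof. by apply/setP => z; rewrite !inE; case: (z == e); case: (z == f); rewrite ?orbT. Qed.

Lemma weight_consC h e f : weight ((e, f) :: h) = weight ((f, e) :: h).
Proof. by apply: eq_bigr => b _; rewrite board_consC. Qed.

Lemma weight_ge0 h : 0 <= weight h.
Proof. by apply: prodr_ge0 => b _; rewrite ler0n. Qed.

Lemma board_cons h e f b : board ((e, f) :: h) b = board h b :\ e :\ f.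
Proof. by apply/setP => z; rewrite /board unoffered_cons !inE -!andbA. Qed.

Lemma board_notin h e f b : col e != b -> col f != b ->
  board ((e, f) :: h) b = board h b.
Proof.
move=> eb fb; rewrite board_cons; apply/setP => z; rewrite !inE.
case: (eqVneq z f) => [->|_] /=; first by rewrite (negbTE fb) andbF.
by case: (eqVneq z e) => [->|_] //=; rewrite (negbTE eb) andbF.
Qed.

(* The factor [r + 1] of a board with [r] unoffered edges pays for the
   discrepancy [2 / (r - 1)] between the two closest derivatives. *)
Lemma potential_step (g : {ffun E -> R} -> R) h :
  potential col g -> (1 < #|unoffered X h|)%N -> exists e f,
    [/\ e \in unoffered X h, f \in unoffered X h, e != f &
     g (state ((e, f) :: h)) * weight ((e, f) :: h) <= g (state h) * weight h /\
     g (state ((f, e) :: h)) * weight ((f, e) :: h) <= g (state h) * weight h].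
Proof.
move=> [g0 ga _ gs] U1; set s := state h; have sC : in_cube s by apply: state_cube.
have c01 : 0 <= (0 : R) <= 1 by lra.
have c11 : 0 <= (1 : R) <= 1 by lra.
have A1 e : e \in unoffered X h -> g (upd s e 0) + g (upd s e 1) = 2 * g s.
  by move=> eU; rewrite ga -[in upd s e _](state_unoffered eU) upd_id.
have A2 e f (t : R) : e != f -> f \in unoffered X h ->
    g (upd (upd s e t) f 0) + g (upd (upd s e t) f 1) = 2 * g (upd s e t).
  move=> ef fU; rewrite ga; congr (2 * g _).
  have -> : 2^-1 = (upd s e t) f.
    by rewrite ffunE eq_sym (negbTE ef) (state_unoffered fU).
  by rewrite upd_id.
have P1 e (t : R) : 0 <= t <= 1 -> 0 <= g (upd s e t).
  by move=> tC; apply/g0/in_cube_upd.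
have P2 e f (t u : R) : 0 <= t <= 1 -> 0 <= u <= 1 -> 0 <= g (upd (upd s e t) f u).
  by move=> tC uC; apply/g0/in_cube_upd => //; apply: in_cube_upd.
case: (boolP [exists b, (1 < #|board h b|)%N]) => [/existsP[b b1]|/existsPn noB].
  (* [d e] is the loss in [g] when Client takes [e]. It lies between [- g s] and [g s], since the
     two outcomes are nonnegative with sum [2 * g s]. *)
  pose d e := (g (upd s e 0) - g (upd s e 1)) / 2.
  have [|e [f [eb fb ef H]]] := @close_values R E (board h b) d (g s) b1.
    move=> e; rewrite mem_board => /andP[/A1 eU _]; have := P1 e 0 c01; have := P1 e 1 c11.
    by rewrite /d; lra.
  move: (eb) (fb); rewrite !mem_board => /andP[eU /eqP ce] /andP[fU /eqP cf].
  exists e, f; split=> //.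
  rewrite (weight_consC _ f) !state_cons // 1?eq_sym // -/s.
  pose W : R := \prod_(c | c != b) (#|board h c|.+1)%:R.
  have -> : weight ((e, f) :: h) = (#|board h b|.-1)%:R * W.
    rewrite /weight (bigD1 b) //=; congr (_%:R * _).
      rewrite board_cons; move: (cardsD1 e (board h b)) (cardsD1 f (board h b :\ e)).
      by rewrite eb in_setD1 eq_sym ef fb; clear; lia.
    by apply: eq_bigr => c cb; rewrite board_notin // ?ce ?cf eq_sym.
  have -> : weight h = (#|board h b|.+1)%:R * W by rewrite /weight (bigD1 b).
  have W0 : 0 <= W by apply: prodr_ge0 => c _; rewrite ler0n.
  rewrite !mulrA.
  have gs' := gs s e f sC ef; rewrite ce cf in gs'; have {}gs' := gs' erefl.
  have r1 : #|board h b|.+1%:R = #|board h b|.-1%:R + 2 :> R.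
    by rewrite -natrD; congr (_%:R); move: b1; clear; lia.
  have r0 : 0 < #|board h b|.-1%:R :> R by rewrite ltr0n; move: b1; clear; lia.
  have := A1 e eU; have := A1 f fU; have := A2 e f 0 ef fU; have := A2 e f 1 ef fU.
  have fe : f != e by rewrite eq_sym.
  have := A2 f e 0 fe eU; have := A2 f e 1 fe eU.
  rewrite ![upd (upd s f _) e _]upd_comm //.
  set a00 := g (upd (upd s e 0) f 0) in gs' *; set a01 := g (upd (upd s e 0) f 1) in gs' *.
  set a10 := g (upd (upd s e 1) f 0) in gs' *; set a11 := g (upd (upd s e 1) f 1) in gs' *.
  move=> e1 e2 e3 e4 e5 e6.
  (* Supermodularity gives [a10 + a01 <= 2 * g s], and [d f - d e] equals [(a10 - a01) / 2]. *)
  have b1' : a10 - g s <= d f - d e by rewrite /d; lra.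
  have b2' : a01 - g s <= d e - d f by rewrite /d; lra.
  have n1 : d e - d f <= `|d e - d f| by rewrite ler_norm.
  have n2 : d f - d e <= `|d e - d f| by rewrite distrC ler_norm.
  have bound a : a - g s <= `|d e - d f| ->
      a * (#|board h b|.-1)%:R * W <= g s * (#|board h b|.+1)%:R * W.
    move=> an; apply: ler_wpM2r => //; rewrite r1.
    have := ler_wpM2r (ltW r0) an; lra.
  by split; apply: bound; [apply: le_trans b1' n2|apply: le_trans b2' n1].
(* No board has two unoffered edges. Any two edges will do: [g] at most quadruples, while each of
   their two boards halves the weight. *)
case/card_gt1P: U1 => e [f [eU fU ef]]; exists e, f; split=> //.
have cef : col e != col f.
  apply/eqP => cef; have /card_le1_eqP H : (#|board h (col e)| <= 1)%N by rewrite leqNgt noB.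
  by move/eqP: ef; apply; apply: H; rewrite mem_board ?eU ?fU ?cef eqxx.
have single e' : e' \in unoffered X h -> board h (col e') = [set e'].
  move=> e'U; apply/eqP; rewrite eq_sym eqEcard sub1set mem_board e'U eqxx cards1.
  by have := noB (col e'); rewrite -leqNgt.
rewrite (weight_consC _ f) !state_cons // 1?eq_sym // -/s.
have -> : weight h = 4 * weight ((e, f) :: h).
  rewrite /weight (bigD1 (col e)) //= (bigD1 (col f)) 1?eq_sym //=.
  rewrite [in RHS](bigD1 (col e)) //= [in RHS](bigD1 (col f)) 1?eq_sym //=.
  rewrite !board_cons !single //.
  have -> : [set e] :\ e :\ f = set0 by apply/setP => z; rewrite !inE; case: (z == e); rewrite ?andbF.
  have -> : [set f] :\ e :\ f = set0.
    by apply/setP => z; rewrite !inE; case: (z == f); rewrite ?andbF.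
  rewrite !cards1 !cards0 !mul1r !mulrA -natrM; congr (_ * _).
  by apply: eq_bigr => b /andP[be bf]; rewrite board_notin // eq_sym.
have fe : f != e by rewrite eq_sym.
have w0 := weight_ge0 ((e, f) :: h).
have := A1 e eU; have := A1 f fU; have := A2 e f 1 ef fU; have := A2 f e 1 fe eU.
have := P1 e 0 c01; have := P1 f 0 c01.
have := P2 e f 1 1 c11 c11; have := P2 f e 1 1 c11 c11.
move=> ? ? ? ? ? ? ? ?.
by split; rewrite mulrA; apply: ler_wpM2r => //; lra.
Qed.

Lemma waiter_forces_potential (e0 : E) (g : {ffun E -> R} -> R) : potential col g ->
  waiter_forces X (fun C => exists y,
    [/\ in_cube y, {in X, forall e, y e = (e \in C)%:R} &
      g y <= g [ffun=> 2^-1] * \prod_b (#|[set e in X | col e == b]|.+1)%:R]).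
Proof.
move=> gP.
have [S [Sl Sp]] := waiter_forces_monovariant e0 (fun h Hh => potential_step gP Hh).
exists S; split=> // h hp U1; have {Sp} := Sp h hp.
have -> : state [::] = [ffun=> 2^-1] by apply/ffunP => e; rewrite !ffunE.
have -> : weight [::] = \prod_b (#|[set e in X | col e == b]|.+1)%:R.
  by apply: eq_bigr => b _; congr (_.+1%:R); apply: eq_card => e; rewrite !inE.
have [c01 c11] : (0 <= (0 : R) <= 1) /\ (0 <= (1 : R) <= 1) by lra.
have sC := state_cube h.
have stE e : e \in X -> e \notin unoffered X h -> state h e = (e \in client_set h)%:R.
  by rewrite unofferedE !inE ffunE => ->; case: (e \in unzip1 h); case: (e \in unzip2 h).
case: (set_0Vmem (unoffered X h)) => [U0|[e eU]] H.
  exists (state h); split=> // [e eX|]; first by rewrite stE // U0 inE.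
  apply: le_trans H; rewrite ler_peMr ?(pot_ge0 gP) //.
  by apply: prodr_natS_ge1.
(* The leftover edge goes to Waiter. Setting it to 0 at most doubles [g], which its board pays for
   with a factor 2 in the weight. *)
exists (upd (state h) e 0); split=> [|e' eX|]; first exact: in_cube_upd.
  rewrite ffunE; case: (eqVneq e' e) => [->|e'e].
    by move: eU; rewrite unofferedE inE => /andP[/negbTE-> _].
  apply: stE => //; apply: contra e'e => e'U; apply/eqP.
  by move/card_le1_eqP: U1; apply.
have w2 : 2 <= weight h.
  rewrite /weight (bigD1 (col e)) //=.
  have eb : (0 < #|board h (col e)|)%N.
    by apply/card_gt0P; exists e; rewrite mem_board eU eqxx.
  have : 2 <= #|board h (col e)|.+1%:R :> R by rewrite ler_nat.
  have : 1 <= \prod_(b | b != col e) #|board h b|.+1%:R :> R.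
    by apply: prodr_natS_ge1.
  nra.
apply: le_trans H.
have := pot_affine gP (state h) e; rewrite -[in upd _ e 2^-1](state_unoffered eU) upd_id.
have := pot_ge0 gP (in_cube_upd e sC c11); have := pot_ge0 gP sC; nra.
Qed.

End Game.

(** * Pseudo-randomness of Client's graph *)

Lemma set2_inj (T : finType) (w w' a a' : T) : w != a' -> w' != a ->
  [set w; a] = [set w'; a'] -> w = w' /\ a = a'.
Proof.
move=> wa wa' /setP e.
have := e w; rewrite !inE eqxx (negbTE wa) orbF => /esym/eqP ww; split=> //.
by have := e a; rewrite !inE eqxx orbT (eq_sym a w') (negbTE wa') /= => /esym/eqP.
Qed.

Lemma uniq_map_inj_in (T1 T2 : eqType) (f : T1 -> T2) (s : seq T1) :
  uniq (map f s) -> {in s &, injective f}.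
Proof.
elim: s => //= x s IH /andP[fx /IH inj] a b; rewrite !inE.
case/predU1P=> [->|aS]; case/predU1P=> [->|bS] // e; last exact: inj.
  by move: fx; rewrite e map_f.
by move: fx; rewrite -e map_f.
Qed.

(* Two edges [wa], [wb] are on the same board only if the point of [w] lies on
   the line orthogonal to the difference of the points of [a] and [b]. *)
Section Colouring.
Variables (T : finType) (F : finFieldType) (pt : T -> F * F).
Hypothesis pt_inj : injective pt.

(** For an edge this is the inner product of the points of its two ends, written as products over
    the edge so that the ends need no order. *)
Definition edge_colour (e : {set T}) : F :=
  \prod_(x in e) (pt x).1 + \prod_(x in e) (pt x).2.

Lemma edge_colour2 w a : w != a ->
  edge_colour [set w; a] = (pt w).1 * (pt a).1 + (pt w).2 * (pt a).2.
Proof.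
move=> wa; rewrite /edge_colour; congr (_ + _).
  by rewrite big_setU1 ?inE //= big_set1.
by rewrite big_setU1 ?inE //= big_set1.
Qed.

Definition separates (w a b : T) := edge_colour [set w; a] != edge_colour [set w; b].

(** The points of these [w] lie on a line through the origin, and one of the two coordinates is
    injective on it. *)
Lemma card_not_separates a b : a != b ->
  (#|[set w | [&& w != a, w != b & ~~ separates w a b]]| <= #|F|)%N.
Proof.
move=> ab; set W := [set w | _].
have line w : w \in W ->
    (pt w).1 * ((pt a).1 - (pt b).1) + (pt w).2 * ((pt a).2 - (pt b).2) = 0.
  rewrite inE => /and3P[wa wb]; rewrite negbK !edge_colour2 // => /eqP e.
  by rewrite !mulrBr addrACA e -opprD subrr.
case: (eqVneq (pt a).2 (pt b).2) => [e2|n2].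
  have n1 : (pt a).1 - (pt b).1 != 0.
    rewrite subr_eq0; apply: contra ab => /eqP e1; apply/eqP/pt_inj.
    by apply/eqP; rewrite -pair_eqE /= e1 e2 !eqxx.
  suff I : {in W &, injective (fun w => (pt w).2)}.
    by rewrite -(card_in_imset I) max_card.
  have z w : w \in W -> (pt w).1 = 0.
    by move/line; rewrite e2 subrr mulr0 addr0 => /eqP; rewrite mulf_eq0 (negbTE n1) orbF => /eqP.
  move=> w w' wW w'W e; apply: pt_inj.
  by apply/eqP; rewrite -pair_eqE /= e !z ?eqxx.
suff I : {in W &, injective (fun w => (pt w).1)}.
  by rewrite -(card_in_imset I) max_card.
move=> w w' wW w'W e; apply: pt_inj; apply/eqP; rewrite -pair_eqE /= e eqxx /=.
have := line _ wW; rewrite e -(line _ w'W) => /addrI /mulIf ->//.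
by rewrite subr_eq0.
Qed.

(** The filter drops pairs of edges on a common board, for which the factor would not be a
    potential. *)
Definition term_index (W : {set T}) (D : seq (T * T)) :=
  [seq t <- [seq (p, w) | p <- D, w <- enum W] | separates t.2 t.1.1 t.1.2].

Definition term_edges (W : {set T}) (D : seq (T * T)) :=
  [seq ([set t.2; t.1.1], [set t.2; t.1.2]) | t <- term_index W D].

Definition vertices (D : seq (T * T)) := unzip1 D ++ unzip2 D.

Lemma mem_term_index W D p w :
  ((p, w) \in term_index W D) = [&& separates w p.1 p.2, p \in D & w \in W].
Proof.
rewrite mem_filter /=; congr (_ && _).
apply/allpairsP/andP => [[[q v] [/= qD vW [-> ->]]]|[pD wW]].
  by rewrite qD -mem_enum.
by exists (p, w); rewrite /= mem_enum.
Qed.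

Lemma size_term_edges (W : {set T}) (D : seq (T * T)) : uniq (vertices D) ->
  {in W, forall w, w \notin vertices D} ->
  (size D * (#|W| - #|F|) <= size (term_edges W D))%N.
Proof.
rewrite size_map /term_index size_filter => Du WD.
have Dp : {in D, forall p, (#|W| - #|F| <= count (fun w => separates w p.1 p.2) (enum W))%N}.
  move=> p pD; have p12 : p.1 != p.2.
    move: Du; rewrite cat_uniq => /and3P[_ /hasPn /(_ p.2 (map_f _ pD)) H _].
    by apply: contraNneq H => <-; apply: map_f.
  rewrite cardE -(count_predC (fun w => separates w p.1 p.2)) leq_subLR addnC leq_add2r.
  apply: leq_trans (card_not_separates p12).
  rewrite -size_filter -(card_uniqP (filter_uniq _ (enum_uniq _))).
  apply: subset_leq_card; apply/subsetP => w.
  rewrite mem_filter mem_enum inE /= => /andP[-> /WD]; rewrite mem_cat negb_or andbT => /andP[w1 w2].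
  by apply/andP; split; [apply: contraNneq w1 => ->|apply: contraNneq w2 => ->]; apply: map_f.
move: Dp; clear Du WD; elim: D => //= p D IH Dp.
rewrite count_cat mulSn leq_add ?IH //; last by move=> q qD; apply: Dp; rewrite inE qD orbT.
by rewrite count_map; apply: Dp; rewrite inE eqxx.
Qed.

(** Since [W] avoids the vertices of [D], an edge between them reveals its end in [W]; since the
    pairs are disjoint, its other end reveals the pair. *)
Lemma term_index_edges_inj (W : {set T}) (D : seq (T * T)) : uniq (vertices D) ->
  {in W, forall w, w \notin vertices D} ->
  {in term_index W D &, forall t u : T * T * T,
    ([set t.2; t.1.1] \in [:: [set u.2; u.1.1]; [set u.2; u.1.2]]) ||
    ([set t.2; t.1.2] \in [:: [set u.2; u.1.1]; [set u.2; u.1.2]]) -> t = u}.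
Proof.
rewrite cat_uniq => /and3P[/uniq_map_inj_in inj1 /hasPn D12 /uniq_map_inj_in inj2] WD.
move=> [[a b] w] [[a' b'] w'] /=; rewrite !mem_term_index => /and3P[_ pD wW] /and3P[_ p'D w'W].
have Dn x p : x \in W -> p \in D -> (x != p.1) /\ (x != p.2).
  move=> /WD; rewrite mem_cat negb_or => /andP[x1 x2] qD.
  by split; [apply: contraNneq x1 => ->|apply: contraNneq x2 => ->]; apply: map_f.
have [w1 w2] := Dn _ _ wW p'D; have [w3 w4] := Dn _ _ w'W pD.
have cross p q : p \in D -> q \in D -> p.1 <> q.2.
  by move=> hp hq e; have := D12 q.2 (map_f _ hq); rewrite -e map_f.
have E1 x y : w != x -> w' != y -> [set w; y] = [set w'; x] -> w = w' /\ y = x.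
  by move=> *; apply: set2_inj.
rewrite !inE -!orbA => /or4P[] /eqP /E1 [] // ww e.
- by rewrite ww (inj1 _ _ pD p'D e).
- by case: (cross _ _ pD p'D e).
- by case: (cross _ _ p'D pD (esym e)).
- by rewrite ww (inj2 _ _ pD p'D e).
Qed.

Lemma term_edges_uniq (W : {set T}) (D : seq (T * T)) : uniq (vertices D) ->
  {in W, forall w, w \notin vertices D} ->
  uniq (term_edges W D) /\ edge_disjoint (term_edges W D).
Proof.
move=> Du WD; have inj := term_index_edges_inj Du WD; split.
  rewrite map_inj_in_uniq.
    apply/filter_uniq/allpairs_uniq; rewrite ?enum_uniq //; last by move=> [? ?] [? ?].
    by move: Du; rewrite cat_uniq => /andP[/map_uniq].
  by move=> t u tL uL [e1 e2]; apply: inj; rewrite // inE e1 eqxx.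
by move=> _ _ /mapP[t tL ->] /mapP[u uL ->] /= /inj ->.
Qed.

End Colouring.

(** * The potential of a family of pairs, at the start and at the end *)

Section TermPotential.
Variables (R : realFieldType) (T : finType) (F : finFieldType) (pt : T -> F * F).
Hypothesis pt_inj : injective pt.
Implicit Types (W : {set T}) (D : seq (T * T)) (y : {ffun {set T} -> R}).

Definition term W D y : R := \prod_(p <- term_edges pt W D) both_factor p y.

Definition admissible W D := uniq (vertices D) /\ {in W, forall w, w \notin vertices D}.

Lemma potential_term W D : admissible W D -> potential (edge_colour pt) (term W D).
Proof.
case=> Du WD; have [Lu Ld] := term_edges_uniq pt Du WD.
apply: potential_prod => // _ /mapP[[p w] + ->] /=.
by rewrite mem_term_index => /andP[].
Qed.

Lemma term_half W D : admissible W D ->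
  term W D [ffun=> 2^-1] <= (7 / 8) ^+ (size D * (#|W| - #|F|)).
Proof.
case=> Du WD; rewrite /term.
rewrite (eq_bigr (fun=> 7 / 8)); last by move=> p _; rewrite /both_factor !ffunE; lra.
rewrite big_const_seq count_predT iter_mulr_1; apply: ler_wiXn2l; try lra.
exact: size_term_edges.
Qed.

(** Vertices outside [J] contribute only factors 1, and those in [J] at most [size D * #|J|]
    factors, each at least 1/2. *)
Lemma term_lower W D y (J : {set T}) : in_cube y ->
  {in W, forall w, w \notin J -> {in D, forall p, y [set w; p.1] * y [set w; p.2] = 0}} ->
  2^-1 ^+ (size D * #|J|) <= term W D y.
Proof.
move=> yC H; rewrite /term big_map.
have cJ : (count (fun t : T * T * T => t.2 \in J) (term_index pt W D) <= size D * #|J|)%N.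
  apply: leq_trans (_ : (count (fun t : T * T * T => t.2 \in J) [seq (p, w) | p <- D, w <- enum W] <= _)%N).
    by rewrite /term_index count_filter; apply: sub_count => t /= /andP[].
  elim: D {H} => //= p D IH; rewrite count_cat mulSn leq_add // count_map /=.
  rewrite -size_filter -(card_uniqP (filter_uniq _ (enum_uniq _))).
  by apply: subset_leq_card; apply/subsetP => w; rewrite mem_filter => /andP[].
apply: le_trans (ler_wiXn2l _ _ cJ) _; try lra.
rewrite -sum1_count -[X in _ ^+ X]mul1n.
rewrite (_ : 2^-1 ^+ _ = \prod_(t <- term_index pt W D) (if t.2 \in J then 2^-1 else 1)); last first.
  by rewrite mul1n -prodrXr big_mkcond.
rewrite !big_seq; apply: ler_prod => [[[a b] w]]; rewrite mem_term_index => /and3P[_ pD wW].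
have := yC [set w; a]; have := yC [set w; b]; rewrite /both_factor /=.
case: (boolP (w \in J)) => wJ; first by nra.
by rewrite (H w wW wJ _ pD); lra.
Qed.

End TermPotential.

Definition missed (T : finType) (G : rel T) (D : seq (T * T)) : {set T} :=
  [set w | all (fun p => ~~ (G w p.1 && G w p.2)) D].

Lemma waiter_forces_weaken (E : finType) (X : {set E}) (P Q : {set E} -> Prop) :
  (forall C, P C -> Q C) -> waiter_forces X P -> waiter_forces X Q.
Proof. by move=> PQ [S [Sl SP]]; exists S; split=> // h hp hU; apply/PQ/SP. Qed.

Section Core.
Variables (R : realFieldType) (n : nat) (F : finFieldType) (pt : 'I_n -> F * F).
Hypothesis pt_inj : injective pt.
Variables (S : {set 'I_n}) (g K b : nat).
Hypothesis numeric :
  ((n ^ 2)%:R * (2 ^+ g * (7 / 8) ^+ (#|S| - 2 - #|F|)) +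
   ((n ^ 2) ^ K * 2 ^ n)%:R * (7 / 8) ^+ (K * (b - #|F|))) * ((n ^ 2) ^ #|F|)%:R < 1 :> R.

Lemma boards_bound c : (0 < n)%N ->
  (#|[set e in complete_edges n | edge_colour pt e == c]| < n ^ 2)%N.
Proof.
move=> n0; apply: leq_ltn_trans (_ : (#|complete_edges n| < _)%N).
  by apply: subset_leq_card; apply/subsetP => e; rewrite inE => /andP[].
rewrite card_draws card_ord bin2; apply: leq_ltn_trans (_ : n * n.-1 < _)%N.
  by rewrite -divn2 leq_div.
by rewrite -mulnn ltn_pmul2l // prednK.
Qed.

(** A failure of either conclusion would make a single summand of [Phi] at least 1, whereas
    [numeric] keeps the final [Phi] below 1. *)
Lemma waiter_forces_quasirandom : (0 < n)%N ->
  waiter_forces (complete_edges n) (fun C =>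
    (forall u w : 'I_n, u != w ->
       (g <= #|[set x in S | graph_of C x u && graph_of C x w]|)%N) /\
    (forall D : seq ('I_n * 'I_n), size D = K -> uniq (vertices D) ->
       (#|missed (graph_of C) D| < b + 2 * K)%N)).
Proof.
move=> n0.
pose W1 (p : 'I_n * 'I_n) := S :\ p.1 :\ p.2.
pose ok1 (p : 'I_n * 'I_n) := p.1 != p.2.
pose ok2 (t : K.-tuple ('I_n * 'I_n) * {set 'I_n}) :=
  [&& uniq (vertices t.1), [forall w in t.2, w \notin vertices t.1] & (b <= #|t.2|)%N].
(* Fewer than [g] common neighbours leave a term above [2^-1 ^+ g], hence the scaling in the first
   sum. The second sum is a union bound over [K] pairs and over all sets of at least [b] vertices
   that could be missed. *)
pose Phi (y : {ffun {set 'I_n} -> R}) :=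
  \sum_(p | ok1 p) 2 ^+ g * term pt (W1 p) [:: p] y +
  \sum_(t | ok2 t) term pt t.2 t.1 y.
have adm1 p : ok1 p -> admissible (W1 p) [:: p].
  move=> p12; split; first by rewrite /= inE andbT.
  by move=> w; rewrite !inE !negb_or => /and3P[-> ->].
have adm2 t : ok2 t -> admissible t.2 t.1.
  by case/and3P=> tu /forall_inP tW _; split.
have PhiP : potential (edge_colour pt) Phi.
  apply: potential_add; apply: potential_sum => j jok.
    by apply: potential_scale; [apply: exprn_ge0; lra|apply/potential_term/adm1].
  exact/potential_term/adm2.
have Phi0 : Phi [ffun=> 2^-1] <=
    (n ^ 2)%:R * (2 ^+ g * (7 / 8) ^+ (#|S| - 2 - #|F|)) +
    ((n ^ 2) ^ K * 2 ^ n)%:R * (7 / 8) ^+ (K * (b - #|F|)).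
  apply: lerD.
    apply: le_trans (_ : \sum_(p : 'I_n * 'I_n | ok1 p) (2 ^+ g * (7 / 8) ^+ (#|S| - 2 - #|F|)) <= _).
      apply: ler_sum => p /adm1 /(term_half R pt_inj) /le_trans H.
      apply: ler_wpM2l; first by apply: exprn_ge0; lra.
      apply: H; rewrite mul1n; apply: ler_wiXn2l; try lra.
      apply: leq_sub2r; rewrite /W1.
      rewrite (cardsD1 p.1 S) (cardsD1 p.2 (S :\ p.1)) leq_subLR addnA leq_add2r.
      exact: leq_add (leq_b1 _) (leq_b1 _).
    rewrite sumr_const -[X in X <= _]mulr_natl; apply: ler_wpM2r.
      by apply: mulr_ge0; apply: exprn_ge0; lra.
    by rewrite ler_nat; apply: leq_trans (max_card _) _; rewrite card_prod card_ord mulnn.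
  apply: le_trans (_ : \sum_(t | ok2 t) (7 / 8) ^+ (K * (b - #|F|)) <= _).
    apply: ler_sum => t /[dup] /adm2 /(term_half R pt_inj) /le_trans H /and3P[_ _ bt].
    apply: H; rewrite size_tuple; apply: ler_wiXn2l; try lra.
    by rewrite leq_mul2l leq_sub2r ?orbT.
  rewrite sumr_const -[X in X <= _]mulr_natl; apply: ler_wpM2r; first by apply: exprn_ge0; lra.
  rewrite ler_nat; apply: leq_trans (max_card _) _.
  by rewrite card_prod card_tuple card_prod -[#|{set _}|]cardsT -powersetT card_powerset cardsT card_ord mulnn.
apply: (waiter_forces_weaken _ (waiter_forces_potential (complete_edges n) set0 PhiP)) => C [y [yC yX]].
set G := graph_of C; set Q := \prod_c _; move=> Hle.
have Hlt : Phi y < 1.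
  apply: le_lt_trans numeric; apply: le_trans Hle _.
  have Q0 : 0 <= Q by apply: prodr_ge0 => c _; rewrite ler0n.
  apply: ler_pM => //; first by apply: (pot_ge0 PhiP) => e; rewrite ffunE; lra.
  (* The initial weight has one factor for each of the [#|F|] boards, each at most [n ^ 2]. *)
  rewrite /Q -natr_prod ler_nat -(prod_nat_const F).
  by apply: leq_prod => c _; apply: boards_bound.
have termge0 W D : admissible W D -> 0 <= term pt W D y.
  by move=> /(potential_term R pt) P; apply: (pot_ge0 P).
have Phi1 p : ok1 p -> 2 ^+ g * term pt (W1 p) [:: p] y < 1.
  move=> pok; apply: le_lt_trans Hlt; rewrite /Phi (bigD1 p) //= -addrA lerDl.
  apply: addr_ge0; last by apply: sumr_ge0 => t /adm2 /termge0.
  apply: sumr_ge0 => q /andP[/adm1 /termge0 q0 _].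
  by apply: mulr_ge0 q0; apply: exprn_ge0; lra.
have Phi2 t : ok2 t -> term pt t.2 t.1 y < 1.
  move=> tok; apply: le_lt_trans Hlt; rewrite /Phi addrC (bigD1 t) //= -addrA lerDl.
  apply: addr_ge0; first by apply: sumr_ge0 => u /andP[/adm2 /termge0].
  apply: sumr_ge0 => q /adm1 /termge0 q0.
  by apply: mulr_ge0 q0; apply: exprn_ge0; lra.
have edge x z : x != z -> y [set x; z] = (G x z)%:R.
  by move=> xz; rewrite yX /G /graph_of ?xz // inE cards2 xz.
have nonjoined W D p w : admissible W D -> w \in W -> p \in D -> ~~ (G w p.1 && G w p.2) ->
    y [set w; p.1] * y [set w; p.2] = 0.
  move=> [_ WD] /WD; rewrite mem_cat negb_or => /andP[w1 w2] pD.
  have wp1 : w != p.1 by apply: contraNneq w1 => ->; apply: map_f.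
  have wp2 : w != p.2 by apply: contraNneq w2 => ->; apply: map_f.
  by rewrite !edge // -natrM mulnb => /negbTE ->.
split=> [u w uw|D sD Du].
  pose J := [set x in S | G x u && G x w]; rewrite leqNgt; apply/negP => Jg.
  have := Phi1 (u, w) uw; apply/negP; rewrite -leNgt.
  have H : 2^-1 ^+ (1 * #|J|) <= term pt (W1 (u, w)) [:: (u, w)] y.
    apply: (@term_lower _ _ _ pt (W1 (u, w)) [:: (u, w)]) => // x xW xJ p.
    rewrite inE => /eqP ->; apply: (nonjoined (W1 (u, w)) [:: (u, w)]) => //=.
    - exact: adm1.
    - by rewrite inE.
    - by move: xW xJ; rewrite !inE => /and3P[_ _ ->].
  have H1 : 1 <= 2 ^+ g * 2^-1 ^+ (1 * #|J|) :> R.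
    have -> : 2 ^+ g = 2 ^+ (g - #|J|) * 2 ^+ #|J| :> R by rewrite -exprD subnK // ltnW.
    rewrite mul1n exprVn mulfK; last by rewrite expf_neq0 // pnatr_eq0.
    by apply: exprn_ege1; rewrite ler1n.
  by apply: le_trans H1 _; apply: ler_wpM2l => //; apply: exprn_ge0; rewrite ler0n.
rewrite ltnNge; apply/negP => Mb.
(* A term requires its set to avoid the vertices of [D]; removing these costs the [2 * K] in the
   bound. *)
pose W := missed G D :\: [set x in vertices D].
have sDt : size D == K by apply/eqP.
have tok : ok2 (Tuple sDt, W).
  apply/and3P; split=> //=.
    by apply/forall_inP => w; rewrite !inE => /andP[].
  have vK : (#|[set x in vertices D]| <= 2 * K)%N.
    by rewrite cardsE (leq_trans (card_size _)) // size_cat !size_map sD mul2n addnn.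
  rewrite -(leq_add2r (2 * K)); apply: leq_trans Mb _.
  apply: leq_trans (_ : #|W :|: [set x in vertices D]| <= _)%N.
    apply: subset_leq_card; apply/subsetP => x xM; rewrite in_setU in_setD xM.
    by case: (x \in [set _ in _]).
  by apply: leq_trans (leq_card_setU _ _).1 _; rewrite leq_add2l.
have := Phi2 _ tok; apply/negP; rewrite -leNgt /=.
have := @term_lower R _ _ pt W D y set0 yC; rewrite cards0 muln0 expr0; apply.
move=> w wW _ p pD; apply: (nonjoined W D) => //; first exact: (adm2 _ tok).
by move: wW; rewrite !inE => /andP[_ /allP/(_ p pD)].
Qed.
End Core.

(** * Numerical choices for the game *)

Lemma linear_le_exp2 (a : nat) : exists m0, forall m, (m0 <= m -> a * m.+1 <= 2 ^ m)%N.
Proof.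
exists (4 * a)%N => m am; pose j := (m %/ 2)%N.
have jm : (j + j <= m /\ m.+1 <= 2 * j.+1 /\ 2 * a <= j)%N by rewrite /j; lia.
have [j2 [mj aj]] := jm.
apply: leq_trans (_ : 2 ^ (j + j) <= _)%N; last by rewrite leq_exp2l.
have := ltn_expl j (isT : (1 < 2)%N); rewrite expnD => H.
apply: leq_trans (_ : a * (2 * j.+1) <= _)%N; first by rewrite leq_mul2l mj orbT.
by rewrite mulnCA mulnA; apply: leq_mul => //; apply: leq_trans aj (ltnW H).
Qed.

(** Because [(7 / 8) ^+ 6 <= 2^-1]. *)
Lemma seven_eighths (R : realFieldType) (k e : nat) : (6 * k <= e)%N ->
  (7 / 8) ^+ e <= (2^-1) ^+ k :> R.
Proof.
move=> ke; apply: le_trans (ler_wiXn2l _ _ ke) _; try lra.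
rewrite exprM; apply: lerXn2r; rewrite ?nnegrE; try lra.
Qed.

Lemma inj_into_plane (n : nat) (F : finFieldType) : (n <= #|F| * #|F|)%N ->
  exists pt : 'I_n -> F * F, injective pt.
Proof.
rewrite -card_prod => le; exists (fun i => enum_val (widen_ord le i)).
by move=> i j /enum_val_inj /(congr1 val) /= /val_inj.
Qed.

Definition initial_part (n k : nat) : {set 'I_n} := [set i : 'I_n | (i < k)%N].

Lemma card_initial_part (n k : nat) : (k <= n)%N -> #|initial_part n k| = k.
Proof.
move=> kn; have wI : injective (widen_ord kn) by move=> i j /(congr1 val) /= /val_inj.
rewrite -[RHS](card_ord k) -(card_imset _ wI).
apply: eq_card => i; rewrite inE; apply/idP/imsetP => [ik|[j _ ->] /=]; last exact: ltn_ord j.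
by exists (Ordinal ik) => //; apply: val_inj.
Qed.

(** Everything is compared with powers of two; the extra 2 in each exponent brings each of the two
    summands down to 1/4. *)
Lemma potential_bound (R : realFieldType) (n m q s g K b : nat) :
  (n ^ 2 <= 2 ^ (4 * m))%N ->
  (6 * (4 * m + g + 4 * m * q + 2) <= s - 2 - q)%N ->
  (6 * (4 * m * K + n + 4 * m * q + 2) <= K * (b - q))%N ->
  ((n ^ 2)%:R * (2 ^+ g * (7 / 8) ^+ (s - 2 - q)) +
   ((n ^ 2) ^ K * 2 ^ n)%:R * (7 / 8) ^+ (K * (b - q))) * ((n ^ 2) ^ q)%:R < 1 :> R.
Proof.
move=> n2m ex1 ex2; set n2' := (n ^ 2)%:R.
have n2R : n2' <= 2 ^+ (4 * m) :> R by rewrite /n2' -natrX ler_nat.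
have n20 : 0 <= n2' :> R by rewrite ler0n.
have A1 : (7 / 8) ^+ (s - 2 - q) <= 2^-1 ^+ (4 * m + g + 4 * m * q + 2) :> R by apply: seven_eighths.
have A2 : (7 / 8) ^+ (K * (b - q)) <= 2^-1 ^+ (4 * m * K + n + 4 * m * q + 2) :> R by apply: seven_eighths.
have Q : ((n ^ 2) ^ q)%:R <= 2 ^+ (4 * m * q) :> R.
  by rewrite natrX exprM lerXn2r // nnegrE exprn_ge0.
have B2 : ((n ^ 2) ^ K * 2 ^ n)%:R <= 2 ^+ (4 * m * K + n) :> R.
  rewrite natrM (natrX _ (n ^ 2)) (natrX _ 2) -/n2' exprD.
  apply: ler_pM; rewrite ?exprn_ge0 //.
  by rewrite exprM; apply: lerXn2r; rewrite ?nnegrE ?exprn_ge0.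
have half (a k : nat) : 2 ^+ a * 2^-1 ^+ (a + k + 2) * 2 ^+ k = 4^-1 :> R.
  rewrite -addnA !exprD [2^-1 ^+ 2]expr2 !exprVn.
  have : 2 ^+ a != 0 :> R by rewrite expf_neq0 // pnatr_eq0.
  have : 2 ^+ k != 0 :> R by rewrite expf_neq0 // pnatr_eq0.
  by move=> h1 h2; field; rewrite h1 h2.
have mul3 (x y z x' y' z' : R) : 0 <= x -> x <= x' -> 0 <= y -> y <= y' -> 0 <= z -> z <= z' ->
    x * y * z <= x' * y' * z'.
  by move=> *; apply: ler_pM; rewrite ?mulr_ge0 //; apply: ler_pM.
have p78 k : 0 <= (7 / 8) ^+ k :> R by rewrite exprn_ge0 // divr_ge0.
have T1 : n2' * (2 ^+ g * (7 / 8) ^+ (s - 2 - q)) * ((n ^ 2) ^ q)%:R <= 4^-1 :> R.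
  rewrite -(half (4 * m + g)%N (4 * m * q)%N) mulrA.
  apply: mul3; rewrite ?ler0n ?p78 ?mulr_ge0 ?exprn_ge0 //.
  by rewrite exprD; apply: ler_pM; rewrite ?exprn_ge0.
have T2 : ((n ^ 2) ^ K * 2 ^ n)%:R * (7 / 8) ^+ (K * (b - q)) * ((n ^ 2) ^ q)%:R <= 4^-1 :> R.
  rewrite -(half (4 * m * K + n)%N (4 * m * q)%N).
  by apply: mul3; rewrite ?ler0n.
rewrite mulrDl; apply: le_lt_trans (lerD T1 T2) _.
by clear; lra.
Qed.

(** A field of order [2 ^ m], with [4 ^ m] the first power of 4 to reach [n], has a plane large
    enough for the vertices. There are then order sqrt(n) boards, and their weight costs order
    sqrt(n) log(n) in exponents that are linear in [n]. *)
Lemma waiter_forces_quasirandom_large (d : nat) : (0 < d)%N ->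
  exists K N, (0 < K)%N /\ forall n, (N <= n)%N ->
  waiter_forces (complete_edges n) (fun C =>
    (forall u w : 'I_n, u != w ->
      (n %/ 16 %/ 12 <= #|[set x in initial_part n (n %/ 16) |
                            graph_of C x u && graph_of C x w]|)%N) /\
    (forall D : seq ('I_n * 'I_n), size D = K -> uniq (vertices D) ->
       (#|missed (graph_of C) D| * d <= n)%N)).
Proof.
move=> d0; pose K := (48 * d)%N.
have [m0 m0P] := linear_le_exp2 (100 * 100 * d).
exists K, (4 ^ m0 + 4 * K * d + 2)%N; split=> [|n nN]; first by rewrite muln_gt0.
have n2 : (1 < n)%N by lia.
pose m := up_log 4 n; have /andP[mlt mle] : (4 ^ m.-1 < n <= 4 ^ m)%N by apply: up_log_bounds.
have mm0 : (m0 <= m)%N.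
  rewrite leqNgt; apply/negP => mm0.
  have : (4 ^ m <= 4 ^ m0)%N by rewrite leq_exp2l // ltnW.
  by move: mle nN; clear; lia.
have mgt0 : (0 < m)%N by rewrite up_log_gt0.
have [F _ Fcard] := pPrimePowerField (isT : prime 2) mgt0.
pose q := (2 ^ m)%N.
have q2 : (q * q < 4 * n)%N.
  by rewrite /q -expnD addnn -muln2 mulnC expnM -(prednK mgt0) expnS ltn_pmul2l.
have [pt ptI] : exists pt : 'I_n -> F * F, injective pt.
  apply: inj_into_plane; rewrite Fcard -expnD addnn -muln2 mulnC expnM.
  exact: mle.
have qm : (100 * 100 * d * m.+1 <= q)%N by apply: m0P.
pose s := (n %/ 16)%N; pose b := (n %/ (2 * d))%N.
have sc : #|initial_part n s| = s by apply: card_initial_part; rewrite /s leq_div.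
have n2m : (n ^ 2 <= 2 ^ (4 * m))%N.
  have -> : (2 ^ (4 * m) = (4 ^ m) ^ 2)%N by rewrite -expnM -[4%N]/(2 ^ 2)%N -expnM; congr expn; lia.
  by rewrite leq_exp2r.
have [ex1 ex2] : (6 * (4 * m + s %/ 12 + 4 * m * q + 2) <= s - 2 - q /\
    6 * (4 * m * K + n + 4 * m * q + 2) <= K * (b - q))%N.
  (* [t] dominates all lower-order products and is at most [n / 2500]. In the first inequality the
     main term [6 * (s %/ 12)] is at most half of [s]. *)
  pose t := (d * m.+1 * q)%N.
  have t1 : (100 * 25 * t <= n)%N.
    have : (100 * 100 * d * m.+1 * q <= q * q)%N by rewrite leq_mul2r qm orbT.
    have -> : (100 * 100 * d * m.+1 * q = 4 * (100 * 25 * t))%N by rewrite /t; clear; lia.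
    by move: q2; clear; lia.
  have q0 : (0 < q)%N by rewrite /q expn_gt0.
  have [t2 t3 t4 t5 t6] : [/\ m * q <= t, q <= t, m * d <= t, d * q <= t & d <= t]%N.
    have mq : (m <= d * m.+1)%N by rewrite (leq_trans (leqnSn m)) // leq_pmull.
    have dm : (d <= d * m.+1)%N by rewrite leq_pmulr.
    have dt : (d * m.+1 <= t)%N by rewrite leq_pmulr.
    rewrite /t; split; rewrite ?leq_mul2r ?mq ?dm ?orbT //.
    - by rewrite leq_pmull // muln_gt0 d0.
    - by rewrite mulnC (leq_trans _ dt) // leq_mul2l leqnSn orbT.
    - exact: leq_trans dm dt.
  have t7 : (m <= t)%N.
    by apply: leq_trans t4; rewrite leq_pmulr.
  have db : (n <= 2 * (d * b) + 2 * d)%N.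
    have := divn_eq n (2 * d); have : (n %% (2 * d) < 2 * d)%N by rewrite ltn_mod muln_gt0.
    by rewrite -/b; move: (n %% (2 * d))%N b => r b'; clear; lia.
  have -> : (4 * m * q = 4 * (m * q))%N by rewrite mulnA.
  have -> : (K * (b - q) = 48 * (d * b - d * q))%N by rewrite /K -mulnA mulnBr.
  have -> : (4 * m * K = 192 * (m * d))%N by rewrite /K; clear; lia.
  move: t1 t2 t3 t4 t5 t6 t7 db; rewrite /s.
  move: (m * q)%N (m * d)%N (d * b)%N (d * q)%N => x1 x2 x3 x4; clear; lia.
apply: (waiter_forces_weaken _ (@waiter_forces_quasirandom rat n F pt ptI (initial_part n s)
   (s %/ 12) K b _ _)) => [C [C1 C2]||]; last by lia.
  split=> [|D sD Du]; first exact: C1.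
  have := C2 D sD Du; rewrite /K /b => H.
  have : (#|missed (graph_of C) D| * d <= (n %/ (2 * d) + 2 * K) * d)%N by rewrite leq_mul2r (ltnW H) orbT.
  have := leq_trunc_div n (2 * d); move: nN; rewrite /K; move: (n %/ _)%N (4 ^ _)%N; clear; nia.
by rewrite sc Fcard; apply: potential_bound n2m ex1 ex2.
Qed.

(** * Rooted trees *)

Section Rooted.
Variables (V : finType) (T : rel V).

(** [par] is arbitrary at the root, hence the guards [x != root]. The second clause says that every
    edge joins a vertex to its parent. *)
Definition rooted_at (root : V) (par : V -> V) (dep : V -> nat) : Prop :=
  (forall x, x != root -> T x (par x) /\ dep x = (dep (par x)).+1) /\
  (forall x y, T x y -> (x != root /\ par x = y) \/ (y != root /\ par y = x)).

Lemma tree_rooted : is_tree T -> exists root par dep, rooted_at root par dep.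
Proof.
case=> -[Tsym Tirr] [V0 Tconn] Tacyc.
have [root _] := card_gt0P V0.
(* [dep] will be the length of a shortest walk from the root and [par] the last vertex but one on
   such a walk. *)
pose walk x k := [exists p : k.-tuple V, path T root p && (last root p == x)].
have walkP x k : reflect (exists p, [/\ path T root p, last root p = x & size p = k]) (walk x k).
  apply: (iffP existsP) => [[p /andP[pp /eqP pl]]|[p [pp pl /eqP ps]]].
    by exists p; rewrite size_tuple.
  by exists (Tuple ps); rewrite /= pp pl eqxx.
have ex x : exists k, walk x k.
  by have /connectP[p pp pl] := Tconn root x; exists (size p); apply/walkP; exists p.
pose dep x := ex_minn (ex x).
have depP x : walk x (dep x) by rewrite /dep; case: ex_minnP.
have depm x k : walk x k -> (dep x <= k)%N by rewrite /dep; case: ex_minnP => ? ? H /H.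
have parE x : exists z, x != root -> T x z /\ dep x = (dep z).+1.
  case: (eqVneq x root) => [_|xr]; first by exists x.
  have /walkP[p [pp pl ps]] := depP x; case/lastP: p pp pl ps => [_ /= rx|p z].
    by rewrite rx eqxx in xr.
  rewrite rcons_path last_rcons size_rcons => /andP[pp zx] zE ps; rewrite {z}zE in zx.
  exists (last root p) => _; rewrite Tsym; split=> //; apply/eqP; rewrite eqn_leq; apply/andP; split.
    apply: depm; apply/walkP; have /walkP[q [qp ql qs]] := depP (last root p).
    by exists (rcons q x); rewrite rcons_path last_rcons size_rcons ql qp qs.
  by rewrite -ps ltnS; apply: depm; apply/walkP; exists p.
have [par parP] := fin_all_exists parE.
exists root, par, dep; split=> // x y xy.
case: (boolP ((x != root) && (par x == y))) => [/andP[? /eqP]|nx]; first by left.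
case: (boolP ((y != root) && (par y == x))) => [/andP[? /eqP]|ny]; first by right.
exfalso.
(* Deleting the edge [xy] keeps all parent edges, so [x] and [y] remain connected. *)
pose e a b := T a b && ~~ (((a == x) && (b == y)) || ((a == y) && (b == x))).
have esym : symmetric e.
  by move=> a b; rewrite /e Tsym orbC (andbC (a == y)) (andbC (a == x)).
have toroot d z : (dep z <= d)%N -> connect e z root.
  elim: d z => [|d IH] z zd; case: (eqVneq z root) => [->|zr]; rewrite ?connect0 //;
    have [zp zdep] := parP z zr; first by rewrite zdep in zd.
  apply: connect_trans (IH (par z) _); last by rewrite -ltnS -zdep.
  apply: connect1; rewrite /e zp negb_or /=.
  apply/andP; split; [apply: contra nx|apply: contra ny] => /andP[/eqP <- /eqP ->];
    by rewrite zr eqxx.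
have : connect e x y.
  apply: connect_trans (toroot _ _ (leqnn _)) _.
  by rewrite (sym_connect_sym esym) (toroot _ _ (leqnn _)).
case/connectP => p pp; case/shortenP: pp => q qp qu _ yq.
apply: (Tacyc (x :: q)).
  (* The cycle is long enough: an empty path would make [xy] a loop, and a path of one step would be
     the deleted edge. *)
  case: q qp yq {qu} => [|z [|? ?]] //= => [_ yx|/andP[]]; first by rewrite yx Tirr in xy.
  by move=> + _ yz; rewrite /e -yz !eqxx /= andbF.
rewrite /ucycle qu andbT /= rcons_path -yq Tsym xy andbT.
by apply: sub_path qp => a b /andP[].
Qed.

Variables (root : V) (par : V -> V) (dep : V -> nat).
Hypothesis rT : rooted_at root par dep.

Definition children x := [set y | (y != root) && (par y == x)].

Lemma sum_children : (\sum_x #|children x| = #|V|.-1)%N.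
Proof.
have -> : #|V|.-1 = #|[set~ root]| by rewrite cardsC1.
rewrite -sum1_card [RHS](partition_big par xpredT) //=.
by apply: eq_bigr => x _; rewrite -sum1_card; apply: eq_bigl => y; rewrite !inE.
Qed.

(** The numbers of children sum to [#|V|.-1], so at most half that many vertices have two or
    more. *)
Lemma card_few_children :
  (#|V|.-1 <= 2 * #|[set x | (x != root) && (#|children x| <= 1)]|)%N.
Proof.
set Q := [set x | _]; pose M := [set x | (1 < #|children x|)%N].
have M2 : (2 * #|M| <= #|V|.-1)%N.
  rewrite -sum_children mulnC -sum_nat_const [X in (_ <= X)%N](bigID (mem M)) /=.
  by rewrite (leq_trans _ (leq_addr _ _)) // leq_sum // => x; rewrite inE.
have : (#|[set: V]| <= #|Q :|: M :|: [set root]|)%N.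
  apply: subset_leq_card; apply/subsetP => x _; rewrite !inE.
  by case: eqP => //= _; case: leqP.
have := leq_card_setU (Q :|: M) [set root]; have := leq_card_setU Q M.
rewrite cardsT cards1 => -[+ _] [+ _]; move: M2.
by move: #|_ :|: _| #|_ :|: _| #|Q| #|M| #|V| => *; lia.
Qed.

(** A vertex with at most one child has degree at most two. Of these vertices, the larger depth
    parity class is taken: depths of adjacent vertices differ by one. *)
Lemma exists_independent : exists I : {set V},
  [/\ (#|V|.-1 <= 4 * #|I|)%N,
      {in I, forall x, (#|[set z | T x z]| <= 2)%N} &
      {in I & I, forall x y, ~~ T x y}].
Proof.
have [rT1 rT2] := rT.
set Q := [set x | (x != root) && (#|children x| <= 1)%N].
pose P b := [set x in Q | odd (dep x) == b].
have [b Pb] : exists b, (#|V|.-1 <= 4 * #|P b|)%N.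
  have : (#|Q| <= #|P true :|: P false|)%N.
    apply: subset_leq_card; apply/subsetP => x.
    by rewrite !inE => ->; case: (odd _).
  have := leq_card_setU (P true) (P false); have := card_few_children; rewrite -/Q => h1 [h2 _] h3.
  case: (leqP #|P true| #|P false|) => h4; [exists false|exists true].
    by move: h1 h2 h3 h4; move: #|_ :|: _| #|Q| #|P _| #|P _| #|V| => *; lia.
  by move: h1 h2 h3 h4; move: #|_ :|: _| #|Q| #|P _| #|P _| #|V| => *; lia.
exists (P b); split=> // [x|x y].
  rewrite !inE => /andP[/andP[xr xc] _].
  apply: leq_trans (_ : #|par x |: children x| <= _)%N.
    apply: subset_leq_card; apply/subsetP => z; rewrite !inE => /rT2[[_ ->]|[-> ->]]; rewrite eqxx ?orbT //.
  by rewrite cardsU1; case: (_ \notin _) => //=; lia.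
rewrite !inE => /andP[/andP[xr _] /eqP xb] /andP[/andP[yr _] /eqP yb].
apply/negP => /rT2[[_ e]|[_ e]].
  by have [_] := rT1 x xr; rewrite e => /(congr1 odd); rewrite /= xb yb; case: (b).
by have [_] := rT1 y yr; rewrite e => /(congr1 odd); rewrite /= xb yb; case: (b).
Qed.

End Rooted.

(** * Embedding *)

(** By [exp(-128 b) <= 1 - 64 b] and [exp b <= 1 + 2 b], the change is at most
    [b * (2 * (a - k) - 64 * k)], and [a - k <= 31 * k]. *)
Lemma convex_exp_step (R : realType) (b k a : R) : 0 <= b -> 128 * b <= 1 ->
  0 <= k -> k <= a -> a <= 32 * k ->
  k * expR (- (128 * b)) + (a - k) * expR b <= a.
Proof.
move=> b0 b1 k0 ka ak.
have inv x : expR (- x) * expR x = 1 :> R by rewrite -expRD addNr expR0.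
have e1 : expR b <= 1 + 2 * b.
  have := expR_gt0 b; have := expR_ge1Dx (- b); have := inv b; nra.
have e2 : expR (- (128 * b)) <= 1 - 64 * b.
  have := expR_gt0 (- (128 * b)); have := expR_ge1Dx (128 * b); have := inv (128 * b); nra.
have h1 := ler_wpM2l k0 e2.
have ak0 : 0 <= a - k by lra.
have h2 := ler_wpM2l ak0 e1. nra.
Qed.

Section Embedding.
Variables (R : realType) (V U : finType) (T : rel V) (G : rel U).
Variables (root : V) (par : V -> V) (dep : V -> nat).
Variables (I I1 : {set V}) (S : {set U}) (Delta g K m : nat).
Hypotheses (Tsym : symmetric T) (rT : rooted_at T root par dep).
Hypotheses (Gsym : symmetric G) (cardVU : #|V| = #|U|).
Hypotheses (I1I : I1 \subset I) (Ideg : {in I, forall x, (#|[set z | T x z]| <= 2)%N})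
  (Iind : {in I & I, forall x y, ~~ T x y}).
Hypothesis degT : forall x, (#|[set y | T x y]| <= Delta)%N.
Hypothesis codeg : forall u w, (g <= #|[set x in S | G x u && G x w]|)%N.
Hypothesis few_missed : forall D : seq (U * U), size D = K -> uniq (vertices D) ->
  (#|missed G D| < m)%N.

Implicit Types (f : V -> U) (Dn : {set V}) (v x : V) (y w u : U).

Section Averaging.
Variables (lam : R).
(* [M - 1 >= 4 * 32]: a random image is adjacent to [w] with probability at
   least 1/32, so the expected change of [exp_load] below is nonpositive. *)
Let M : R := 129.
Hypotheses (lam0 : 0 <= lam) (lamM : 128 * (lam * (Delta%:R * M)) <= 1).

Definition place (f : V -> U) (v : V) (y : U) : V -> U :=
  fun z => if z == v then y else f z.

(* The weight of [x] for the candidate image [w]: it grows by [M] with each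
   neighbour of [x] placed next to [w] and vanishes once one is placed elsewhere. *)
Definition load (f : V -> U) (Dn : {set V}) (w : U) (x : V) : R :=
  if [forall z in Dn, T x z ==> G w (f z)] then M ^+ #|[set z in Dn | T x z]| else 0.

Definition total_load f Dn w := \sum_(x in I1) load f Dn w x.

Definition local_load f Dn w v := \sum_(x in I1 | T x v) load f Dn w x.

Lemma load_ge0 f Dn w x : 0 <= load f Dn w x.
Proof. by rewrite /load; case: ifP => // _; apply: exprn_ge0; rewrite /M; lra. Qed.

Lemma load_place f Dn v y w x : v \notin Dn ->
  load (place f v y) (v |: Dn) w x =
  if T x v then (if G w y then M * load f Dn w x else 0) else load f Dn w x.
Proof.
move=> vD; rewrite /load.
have old z : z \in Dn -> place f v y z = f z.
  by move=> zD; rewrite /place; case: eqP zD vD => // -> ->.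
have -> : [forall z in v |: Dn, T x z ==> G w (place f v y z)] =
    (T x v ==> G w y) && [forall z in Dn, T x z ==> G w (f z)].
  apply/forall_inP/andP => [H|[Hv /forall_inP H] z].
    split; first by have := H v; rewrite setU11 /place eqxx; apply.
    by apply/forall_inP => z zD; rewrite -old // H // inE zD orbT.
  by rewrite !inE => /predU1P[->|zD]; [rewrite /place eqxx|rewrite old // H].
case: (boolP (T x v)) => xv /=.
  case: (G w y) => //=; case: ifP => _; last by rewrite mulr0.
  rewrite -exprS; congr (_ ^+ _); rewrite (cardsD1 v) !inE eqxx xv /= add1n; congr _.+1.
  apply: eq_card => z; rewrite !inE; case: (eqVneq z v) => [->|_] //=.
  by rewrite (negbTE vD).
case: ifP => _ //; congr (_ ^+ _); apply: eq_card => z; rewrite !inE.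
by case: (eqVneq z v) => [->|_] //=; rewrite (negbTE xv) andbF.
Qed.

Lemma total_load_place f Dn v y w : v \notin Dn ->
  total_load (place f v y) (v |: Dn) w =
  total_load f Dn w + (if G w y then 128 else - 1) * local_load f Dn w v.
Proof.
move=> vD; rewrite /total_load /local_load mulr_sumr.
rewrite (bigID (fun x => T x v)) /= [in RHS](bigID (fun x => T x v)) /= addrAC.
rewrite -big_split /=; congr (_ + _); apply: eq_bigr => x /andP[_ xv].
  by rewrite load_place // xv /M; case: (G w y); lra.
by rewrite load_place // (negbTE xv).
Qed.

(** A vertex of [I1] next to the unplaced [v] has at most one placed neighbour, so its load is at
    most [M]; [v] has at most [Delta] neighbours. *)
Lemma local_load_bound f Dn w v : v \notin Dn ->
  0 <= local_load f Dn w v <= Delta%:R * M.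
Proof.
move=> vD; apply/andP; split; first by apply: sumr_ge0 => x _; apply: load_ge0.
apply: le_trans (_ : \sum_(x in I1 | T x v) M <= _).
  apply: ler_sum => x /andP[xI xv]; rewrite /load; case: ifP => _; last by rewrite /M; lra.
  have xd : (#|[set z in Dn | T x z]| <= 1)%N.
    have := Ideg (subsetP I1I _ xI); rewrite (cardsD1 v) inE xv add1n ltnS.
    apply: leq_trans; apply: subset_leq_card; apply/subsetP => z; rewrite !inE => /andP[zD ->].
    by rewrite andbT; apply: contraNneq vD => <-.
  rewrite -[leRHS]expr1; apply: ler_weXn2l => //; rewrite /M; lra.
rewrite sumr_const -[X in X <= _]mulr_natl; apply: ler_wpM2r; first by rewrite /M; lra.
rewrite ler_nat; apply: leq_trans (degT v); apply: subset_leq_card; apply/subsetP => x.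
by rewrite !inE Tsym => /andP[].
Qed.

(** A Chernoff-type sum: keeping it small keeps every [total_load] large. *)
Definition exp_load f Dn := \sum_w expR (- (lam * total_load f Dn w)).

(** Method of conditional expectations: averaged over [y] in [Av], the summand of each [w] does not
    increase by [convex_exp_step], so a minimizing [y] serves. *)
Lemma exists_light_image f Dn v (Av : {set U}) : v \notin Dn -> Av != set0 ->
  (forall w, (#|Av| <= 32 * #|[set y in Av | G w y]|)%N) ->
  exists2 y, y \in Av & exp_load (place f v y) (v |: Dn) <= exp_load f Dn.
Proof.
move=> vD A0 AG; have [y0 y0A] := set0Pn _ A0.
pose h y := exp_load (place f v y) (v |: Dn).
have [y yA ymin] : exists2 y, y \in Av & {in Av, forall z, h y <= h z}.
  by case: (Order.TotalTheory.arg_minP h y0A) => y yA ymin; exists y.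
exists y => //; have a0 : 0 < #|Av|%:R :> R by rewrite ltr0n card_gt0.
rewrite -/(h y) -(ler_pM2l a0) mulr_natl -sumr_const.
apply: le_trans (_ : \sum_(z in Av) h z <= _); first exact: ler_sum.
rewrite /h /exp_load exchange_big mulr_sumr; apply: ler_sum => w _.
set b := lam * local_load f Dn w v; set t := total_load f Dn w.
have [lb0 lb1] := andP (local_load_bound f w vD).
have b0 : 0 <= b by apply: mulr_ge0.
have b1 : 128 * b <= 1.
  by apply: le_trans lamM; rewrite ler_pM2l // ler_wpM2l.
have E z : expR (- (lam * total_load (place f v z) (v |: Dn) w)) =
    expR (- (lam * t)) * (if G w z then expR (- (128 * b)) else expR b).
  by rewrite total_load_place // -/t; case: (G w z); rewrite -expRD; congr expR; rewrite /b; lra.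
rewrite (eq_bigr _ (fun z _ => E z)) -mulr_sumr mulrC ler_pM2r ?expR_gt0 //.
rewrite (bigID (G w)) /=.
rewrite (eq_bigr (fun=> expR (- (128 * b)))); last by move=> z /andP[_ ->].
rewrite [X in _ + X](eq_bigr (fun=> expR b)); last by move=> z /andP[_ /negbTE->].
rewrite !sumr_const -[X in X + _ <= _]mulr_natr -[X in _ + X <= _]mulr_natr.
set k := #|_|; set k' := #|_|.
have kE : #|[set y in Av | G w y]| = k by rewrite cardsE.
have kk : #|Av| = (k + k')%N.
  rewrite -(cardID (G w) (mem Av)); congr (_ + _)%N; apply: eq_card => z; rewrite !inE //.
  by rewrite andbC.
have {AG} := AG w; rewrite kE kk => AG.
rewrite mulrC [X in _ + X]mulrC.
have -> : k'%:R = (k + k')%:R - k%:R :> R by rewrite natrD addrAC subrr add0r.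
by apply: convex_exp_step => //; rewrite ?ler0n // ?ler_nat ?leq_addr // -natrM ler_nat.
Qed.

(** * Top-down embedding of the vertices outside the independent set *)

Definition attached : {set V} := [set z | [exists x in I1, T x z]].

Definition free f Dn : {set U} := ~: S :\: f @: Dn.

Record partial_embedding f Dn : Prop := PartialEmbedding {
  pe_sub : Dn \subset ~: I;
  pe_inj : {in Dn &, injective f};
  pe_edge : {in Dn, forall v, v != root -> par v \notin I ->
    par v \in Dn /\ G (f (par v)) (f v)};
  pe_attached : {in Dn, forall v, v \in attached -> f v \in S};
  pe_overflow : {in Dn, forall v, v \notin attached -> f v \in S ->
    [/\ v != root, par v \notin I & {in free f Dn, forall z, ~~ G (f (par v)) z}]};
  pe_load : exp_load f Dn <= #|U|%:R * expR (- (lam * #|I1|%:R)) }.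

Lemma partial_embedding_empty f : partial_embedding f set0.
Proof.
split; try by [rewrite sub0set|move=> v; rewrite inE|move=> v w; rewrite inE].
rewrite /exp_load (eq_bigr (fun=> expR (- (lam * #|I1|%:R)))).
  by rewrite sumr_const -[X in X <= _]mulr_natl.
move=> w _; congr (expR (- (lam * _))); rewrite /total_load (eq_bigr (fun=> 1)) ?sumr_const //.
move=> x _; rewrite /load; have -> : [set z in set0 | T x z] = set0.
  by apply/setP => z; rewrite !inE.
rewrite cards0 expr0; case: ifP => // /negbT /forall_inPn[z]; by rewrite inE.
Qed.

Lemma partial_embedding_step f Dn v y : partial_embedding f Dn ->
  v \notin Dn -> v \notin I -> y \notin f @: Dn ->
  (v != root -> par v \notin I -> par v \in Dn /\ G (f (par v)) y) ->
  (v \in attached -> y \in S) ->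
  (v \notin attached -> y \in S -> [/\ v != root, par v \notin I &
     {in free f Dn, forall z, ~~ G (f (par v)) z}]) ->
  exp_load (place f v y) (v |: Dn) <= exp_load f Dn ->
  partial_embedding (place f v y) (v |: Dn).
Proof.
case=> Dsub Dinj Dedge Datt Dover Dload vD vI yD vedge vatt vover le.
have fv : place f v y v = y by rewrite /place eqxx.
have old z : z \in Dn -> place f v y z = f z.
  by move=> zD; rewrite /place; case: eqP zD vD => // -> ->.
have im : place f v y @: (v |: Dn) = y |: f @: Dn.
  rewrite imsetU1 fv; congr (_ |: _); apply/setP => u; apply/imsetP/imsetP => -[z zD ->];
    by exists z => //; rewrite old.
(* Free vertices only disappear, so earlier overflows stay justified. *)
have freeS : {subset free (place f v y) (v |: Dn) <= free f Dn}.
  by move=> z; rewrite /free im !inE negb_or -andbA => /and3P[_ -> ->].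
split; last exact: le_trans le Dload.
- by rewrite subUset sub1set inE vI Dsub.
- move=> a b; rewrite !in_setU1 => /predU1P[->|aD] /predU1P[->|bD]; rewrite ?fv ?old // => e.
  + by move: yD; rewrite e imset_f.
  + by move: yD; rewrite -e imset_f.
  + exact: Dinj.
- move=> a; rewrite !in_setU1 => /predU1P[->|aD] ar pI.
    by have [pD H] := vedge ar pI; rewrite fv old // pD orbT.
  by have [pD H] := Dedge a aD ar pI; rewrite !old // pD orbT.
- by move=> a; rewrite !in_setU1 => /predU1P[->|aD]; rewrite ?fv ?old //; apply: Datt.
- move=> a; rewrite !in_setU1 => /predU1P[->|aD] aatt; [rewrite fv|rewrite (old a) //] => aS.
    have [h1 h2 h3] := vover aatt aS; split=> // z /freeS zf.
    by have [pD _] := vedge h1 h2; rewrite old // h3.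
  have [h1 h2 h3] := Dover a aD aatt aS; split=> // z /freeS zf.
  by have [pD _] := Dedge a aD h1 h2; rewrite old // h3.
Qed.

Hypotheses (K0 : (0 < K)%N) (m0 : (0 < m)%N).

(* Otherwise pair up [2 K] of these vertices. *)
Lemma card_isolated_from (Z : {set U}) : (m <= #|Z|)%N ->
  (#|[set u | [forall z in Z, ~~ G u z]]| < 2 * K)%N.
Proof.
move=> mZ; rewrite ltnNge; apply/negP; set X := [set u | _]; rewrite cardE => XK.
pose s1 := take K (enum X); pose s2 := take K (drop K (enum X)).
have z1 : size s1 = K by rewrite size_take; case: ltnP => //; lia.
have z2 : size s2 = K by rewrite size_take size_drop; case: ltnP => //; lia.
have u12 : uniq (vertices (zip s1 s2)).
  rewrite /vertices unzip1_zip ?unzip2_zip ?z1 ?z2 //.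
  have := enum_uniq X; rewrite -{1}(cat_take_drop K (enum X)) -{1}(cat_take_drop K (drop K (enum X))).
  by rewrite catA cat_uniq => /andP[].
have := few_missed (D := zip s1 s2); rewrite size_zip z1 z2 minnn => /(_ erefl u12).
rewrite ltnNge => /negP; apply; apply: leq_trans mZ _; apply: subset_leq_card.
apply/subsetP => z zZ; rewrite inE; apply/allP => -[a b] /= ab.
have : a \in unzip1 (zip s1 s2) by apply: (map_f fst ab).
rewrite unzip1_zip ?z1 ?z2 // => /mem_take; rewrite mem_enum inE => /forall_inP/(_ z zZ).
by rewrite Gsym => /negbTE ->.
Qed.

Lemma card_attached : (#|attached| <= 2 * #|I1|)%N.
Proof.
have -> : attached = \bigcup_(x in I1) [set z | T x z].
  apply/setP => z; rewrite inE; apply/exists_inP/bigcupP => -[x xI xz]; exists x => //.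
    by rewrite inE.
  by rewrite inE in xz.
rewrite mulnC -sum_nat_const; apply: leq_trans (_ : \sum_(x in I1) #|[set z | T x z]| <= _)%N.
  elim/big_rec2: _ => [|x k A _ IH]; first by rewrite cards0.
  by apply: leq_trans (leq_card_setU _ _).1 _; rewrite leq_add2l.
by apply: leq_sum => x /(subsetP I1I) /Ideg.
Qed.

Hypothesis room : (#|S| + m <= #|I|)%N.

(** At most [#|V| - #|I|] of the [#|U| - #|S|] vertices outside [S] are used, and the difference is
    covered by [room]. *)
Lemma card_free f Dn : Dn \subset ~: I -> (m <= #|free f Dn|)%N.
Proof.
move=> DI; have h1 : (#|f @: Dn| <= #|~: I|)%N.
  by apply: leq_trans (leq_imset_card _ _) _; apply: subset_leq_card.
have h2 : (#|~: S| <= #|free f Dn| + #|f @: Dn|)%N.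
  rewrite -(cardsID (f @: Dn) (~: S)) addnC leq_add2l.
  by apply: subset_leq_card; apply: subsetIr.
have h3 := cardsC S; have h4 := cardsC I; move: h1 h2 h3 h4 room cardVU.
rewrite /=; clear.
move: #|f @: Dn| #|~: I| #|~: S| #|free f Dn| #|S| #|I| #|V| #|U| => *; lia.
Qed.

(** Besides images of attached vertices, [S] receives only overflowing children. The images of their
    parents have no free neighbour, so there are fewer than [2 * K] such parents, each with at most
    [Delta] children. *)
Lemma card_used f Dn : partial_embedding f Dn ->
  (#|S :&: f @: Dn| <= 2 * #|I1| + 2 * K * Delta)%N.
Proof.
move=> pe; pose X := [set u | [forall z in free f Dn, ~~ G u z]].
pose Y := \bigcup_(q in Dn | f q \in X) [set z | T q z].
have sub : S :&: f @: Dn \subset f @: (attached :|: Y).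
  apply/subsetP => u /setIP[uS /imsetP[v vD uE]]; rewrite uE in uS *.
  apply: imset_f; rewrite inE; case: (boolP (v \in attached)) => //= va.
  have [vr pI H] := pe_overflow pe vD va uS; have [pD _] := pe_edge pe vD vr pI.
  apply/bigcupP; exists (par v); first by rewrite pD inE; apply/forall_inP.
  by rewrite inE Tsym; case: (rT.1 v vr).
apply: leq_trans (subset_leq_card sub) _; apply: leq_trans (leq_imset_card _ _) _.
apply: leq_trans (leq_card_setU _ _).1 _; apply: leq_add; first exact: card_attached.
apply: leq_trans (_ : \sum_(q in Dn | f q \in X) Delta <= _)%N.
  rewrite /Y; elim/big_rec2: _ => [|x k A _ IH]; first by rewrite cards0.
  by apply: leq_trans (leq_card_setU _ _).1 _; apply: leq_add.
rewrite sum_nat_const leq_mul2r; apply/orP; right.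
have := card_isolated_from (card_free f (pe_sub pe)); apply: leq_trans (leqW _).
rewrite -/X -(card_in_imset (D := [pred q in Dn | f q \in X]) (f := f)).
  by apply: subset_leq_card; apply/subsetP => _ /imsetP[q /andP[_ qX] ->].
by move=> a b /andP[aD _] /andP[bD _]; apply: (pe_inj pe).
Qed.

Hypotheses (narrow : (2 * (2 * #|I1| + 2 * K * Delta) <= g)%N) (g0 : (0 < g)%N)
  (Ssmall : (#|S| <= 16 * g)%N).

Lemma many_choices f Dn u w : partial_embedding f Dn ->
  (g <= 2 * #|[set x in S :\: f @: Dn | G x u && G x w]|)%N.
Proof.
move=> /card_used cu; have := codeg u w.
rewrite -(cardsID (f @: Dn) [set x in S | _]) => cd.
have h1 : (#|[set x in S | G x u && G x w] :&: f @: Dn| <= #|S :&: f @: Dn|)%N.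
  by apply: subset_leq_card; apply/subsetP => x; rewrite !inE => /andP[/andP[-> _] ->].
have -> : [set x in S :\: f @: Dn | G x u && G x w] = [set x in S | G x u && G x w] :\: f @: Dn.
  by apply/setP => x; rewrite !inE -!andbA.
by move: cu cd h1 narrow; clear; move: #|_ :&: _| #|_ :&: _| #|_ :\: _| => *; lia.
Qed.

Lemma partial_embedding_extend f Dn : partial_embedding f Dn -> Dn != ~: I ->
  exists v y, v \notin Dn /\ partial_embedding (place f v y) (v |: Dn).
Proof.
move=> pe DI; have [v0 v0D] : exists v, v \in ~: I :\: Dn.
  by apply/set0Pn; apply: contra DI => /eqP/eqP; rewrite setD_eq0 eqEsubset (pe_sub pe).
(* Least depth ensures that the parent of [v], unless it lies in [I], is already placed. *)
have [v + vmin] : exists2 v, v \in ~: I :\: Dn & {in ~: I :\: Dn, forall z, (dep v <= dep z)%N}.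
  by case: (arg_minnP dep v0D) => v; exists v.
rewrite !inE => /andP[vD vI].
have parD : v != root -> par v \notin I -> par v \in Dn.
  move=> vr pI; apply/negPn/negP => pD; have [_ dv] := rT.1 v vr.
  by have := vmin (par v); rewrite !inE pI pD dv ltnn => /(_ isT).
exists v; suff [y yP] : exists y, [/\ y \notin f @: Dn,
    v != root -> par v \notin I -> G (f (par v)) y,
    v \in attached -> y \in S,
    v \notin attached -> y \in S -> [/\ v != root, par v \notin I &
     {in free f Dn, forall z, ~~ G (f (par v)) z}] &
    exp_load (place f v y) (v |: Dn) <= exp_load f Dn].
  exists y; split=> //; case: yP => h1 h2 h3 h4 h5; apply: partial_embedding_step => //.
  by move=> vr pI; split; [apply: parD|apply: h2].
have choices u w := many_choices u w pe.
case: (boolP (v \in attached)) => va.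
  pose Av := [set y in S :\: f @: Dn |
    if (v != root) && (par v \notin I) then G (f (par v)) y else true].
  have AvG w : (g <= 2 * #|[set y in Av | G w y]|)%N.
    (* Without a placed parent, [w] doubles as [u], so that one codegree bound covers both cases. *)
    pose u := if (v != root) && (par v \notin I) then f (par v) else w.
    apply: leq_trans (choices u w) _; rewrite leq_mul2l /=; apply: subset_leq_card.
    apply/subsetP => y; rewrite /Av /u in_set [in X in _ -> X]in_set [in X in _ -> X]in_set.
    move=> /and3P[-> + yw]; rewrite (Gsym w) yw andbT /=.
    by case: ifP => // _; rewrite Gsym.
  have [||y] := @exists_light_image f Dn v Av vD.
  - apply: contraTneq (AvG (f v)) => ->; rewrite -ltnNge.
    by rewrite (_ : [set y in set0 | _] = set0) ?cards0 ?muln0 //; apply/setP => y; rewrite !inE.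
  (* The ratio 1/32: at least [g / 2] candidates are adjacent to [w], among at most
     [#|S| <= 16 * g]. *)
  - move=> w; apply: leq_trans (_ : 16 * g <= _)%N.
      apply: leq_trans Ssmall; apply: subset_leq_card; apply/subsetP => y.
      by rewrite !inE => /andP[/andP[_ ->]].
    by rewrite -[32%N]/(16 * 2)%N -mulnA leq_mul2l AvG.
  rewrite inE => /andP[/setDP[yS yf] yG] le; exists y; split=> //.
    by move=> vr pI; move: yG; rewrite vr pI.
(* A vertex that is not attached changes no load, so its image may be chosen freely. *)
have sameload y : exp_load (place f v y) (v |: Dn) = exp_load f Dn.
  apply: eq_bigr => w _; rewrite total_load_place //.
  rewrite (_ : local_load f Dn w v = 0) ?mulr0 ?addr0 // /local_load big_pred0 // => x.
  by apply: contraNF va => /andP[xI xv]; rewrite inE; apply/exists_inP; exists x.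
case: (boolP ((v != root) && (par v \notin I))) => [/andP[vr pI]|nv].
  case: (boolP [exists y in free f Dn, G (f (par v)) y]) => [/exists_inP[y]|/exists_inPn H].
    by rewrite !inE => /andP[yf yS] Gy; exists y; split; rewrite ?sameload //; move/negP: yS.
  have /card_gt0P[y] : (0 < #|[set x in S :\: f @: Dn | G x (f (par v)) && G x (f (par v))]|)%N.
    by have := choices (f (par v)) (f (par v)); case: #|_| => //; rewrite leqNgt g0.
  rewrite !inE andbb => /andP[/andP[yf yS] Gy].
  by exists y; split; rewrite ?sameload // Gsym.
have /card_gt0P[y] : (0 < #|free f Dn|)%N by apply: leq_trans m0 (card_free f (pe_sub pe)).
rewrite !inE => /andP[yf yS]; exists y; split; rewrite ?sameload //.
  by move=> vr pI; rewrite vr pI in nv.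
by move/negP: yS.
Qed.

Lemma partial_embedding_exists (u0 : U) : exists f, partial_embedding f (~: I).
Proof.
suff step k : (k <= #|~: I|)%N -> exists f Dn, #|Dn| = k /\ partial_embedding f Dn.
  have [f [Dn [cD pe]]] := step _ (leqnn _); exists f.
  suff <- : Dn = ~: I by [].
  by apply/eqP; rewrite eqEcard (pe_sub pe) cD leqnn.
elim: k => [_|k IH kI].
  by exists (fun=> u0), set0; rewrite cards0; split=> //; apply: partial_embedding_empty.
have [f [Dn [cD pe]]] := IH (ltnW kI).
have [|v [y [vD pe']]] := partial_embedding_extend pe.
  by apply: contraTneq kI => <-; rewrite cD ltnn.
by exists (place f v y), (v |: Dn); rewrite cardsU1 vD cD.
Qed.

(** * Placing the independent set *)

Definition fits f x u := [forall z, T x z ==> G u (f z)].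

Hypothesis log_small : 2 * ln (#|U|%:R : R) <= lam * #|I1|%:R.
Hypothesis I1large : (2 * (129 * 129) * m <= #|I1|)%N.

(** The summand of [w] alone is at most [#|U| * exp(- lam * #|I1|)], so by [log_small] the load of
    [w] is at least half of [#|I1|]. Each vertex adds at most [M * M], and nothing unless it fits
    [w]. *)
Lemma card_fits f w : 0 < lam -> partial_embedding f (~: I) ->
  (m <= #|[set x in I1 | fits f x w]|)%N.
Proof.
move=> lam_gt0 pe; set X := [set x in I1 | _].
have n0 : 0 < #|U|%:R :> R by rewrite ltr0n; apply/card_gt0P; exists w.
have le_tot : #|I1|%:R <= 2 * total_load f (~: I) w.
  have : expR (- (lam * total_load f (~: I) w)) <= #|U|%:R * expR (- (lam * #|I1|%:R)).
    apply: le_trans (pe_load pe); rewrite /exp_load (bigD1 w) //= lerDl.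
    by apply: sumr_ge0 => v _; apply: expR_ge0.
  have nE : expR (ln #|U|%:R) = #|U|%:R :> R by rewrite lnK // posrE.
  rewrite -nE -expRD ler_expR => h.
  by rewrite -(ler_pM2l lam_gt0); move: h log_small; lra.
have tot_le : total_load f (~: I) w <= #|X|%:R * (M * M).
  rewrite /total_load (bigID (fun x => fits f x w)) /= [X in _ + X]big1 ?addr0.
    apply: le_trans (_ : \sum_(x in I1 | fits f x w) M * M <= _).
      apply: ler_sum => x /andP[xI _]; rewrite /load; case: ifP => _; last by rewrite /M; lra.
      have xd : (#|[set z in ~: I | T x z]| <= 2)%N.
        apply: leq_trans (Ideg (subsetP I1I _ xI)); apply: subset_leq_card.
        by apply/subsetP => z; rewrite !inE => /andP[].
      by rewrite -expr2; apply: ler_weXn2l => //; rewrite /M; lra.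
    by rewrite sumr_const -[X in X <= _]mulr_natl /X cardsE.
  move=> x /andP[xI xw]; rewrite /load ifF //; apply: contraNF xw => /forall_inP H.
  apply/forallP => z; apply/implyP => xz; apply: (implyP (H z _)) => //; rewrite inE.
  by apply: contraL xz => zI; apply: Iind => //; apply: (subsetP I1I).
have : (#|I1|%:R : R) <= (2 * (129 * 129) * #|X|)%:R.
  rewrite !natrM; move: le_tot tot_le; rewrite /M; lra.
rewrite ler_nat => h; move: (leq_trans I1large h); rewrite leq_mul2l //.
Qed.

Hypotheses (Ularge : (2 * K + 2 <= #|U|)%N) (I1pos : (0 < #|I1|)%N).

Lemma extend_to_pair (A B : {set U}) : A \subset B -> (#|A| <= 2)%N -> (1 < #|B|)%N ->
  exists a b, [/\ a != b, a \in B, b \in B & A \subset [set a; b]].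
Proof.
move=> AB A2 B2; case: (ltngtP #|A| 1) => [|A2'|/eqP/cards1P[a AE]].
- rewrite ltnS leqn0 cards_eq0 => /eqP ->; have [a [b [aB bB ab]]] := card_gt1P B2.
  by exists a, b; split; rewrite ?sub0set.
- have /cards2P[a [b [ab AE]]] : #|A| == 2%N by rewrite eqn_leq A2.
  exists a, b; move: AB; rewrite AE subUset !sub1set => /andP[aB bB].
  by split=> //; rewrite subUset !sub1set !inE !eqxx orbT.
- have aB : a \in B by apply: (subsetP AB); rewrite AE set11.
  have /card_gt0P[b] : (0 < #|B :\ a|)%N by move: B2; rewrite (cardsD1 a B) aB.
  rewrite !inE => /andP[ba bB]; exists a, b; rewrite eq_sym.
  by split=> //; rewrite AE sub1set !inE eqxx.
Qed.

(** Greedy choice: the at most [2 * k] vertices of earlier pairs spoil at most [2 * K * Delta]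
    members of [X1]. The next pair contains the images of all neighbours of an unspoiled [x]. *)
Lemma disjoint_pairs f (X1 : {set V}) k : partial_embedding f (~: I) -> X1 \subset I ->
  (2 * K * Delta < #|X1|)%N -> (k <= K)%N ->
  exists D : seq (U * U), [/\ size D = k, uniq (vertices D) &
    {in D, forall p, exists2 x, x \in X1 & forall u, G u p.1 -> G u p.2 -> fits f x u}].
Proof.
move=> pe XI Xl; elim: k => [_|k IH kK]; first by exists [::].
have [D [sD Du DX]] := IH (ltnW kK).
have szv : size (vertices D) = (2 * k)%N by rewrite size_cat !size_map sD mul2n addnn.
pose P := [set z in ~: I | f z \in vertices D].
have P2 : (#|P| <= 2 * k)%N.
  have -> : #|P| = #|f @: P|.
    rewrite card_in_imset // => a b; rewrite !in_set => /andP[aI _] /andP[bI _].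
    by apply: (pe_inj pe); rewrite in_setC.
  rewrite -szv; apply: leq_trans (card_size _); apply: subset_leq_card.
  by apply/subsetP => _ /imsetP[z + ->]; rewrite inE => /andP[].
pose kill := \bigcup_(z in P) [set x | T z x].
have killed : (#|kill| <= 2 * K * Delta)%N.
  apply: leq_trans (_ : \sum_(z in P) Delta <= _)%N.
    rewrite /kill; elim/big_rec2: _ => [|x j A _ IH']; first by rewrite cards0.
    by apply: leq_trans (leq_card_setU _ _).1 _; apply: leq_add.
  rewrite sum_nat_const leq_mul2r; apply/orP; right; apply: leq_trans P2 _.
  by rewrite leq_mul2l (ltnW kK) orbT.
have [x xX xk] : exists2 x, x \in X1 & x \notin kill.
  apply/subsetPn/negP => /subset_leq_card; rewrite leqNgt => /negP; apply.
  exact: leq_ltn_trans killed Xl.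
have xI := subsetP XI _ xX.
have nbrI z : T x z -> z \in ~: I.
  by move=> xz; rewrite inE; apply: contraL xz => zI; apply: Iind.
pose B := [set u | u \notin vertices D].
have [|||a [b [ab aB bB AB]]] := @extend_to_pair (f @: [set z | T x z]) B.
- apply/subsetP => _ /imsetP[z + ->]; rewrite !inE => xz; apply: contra xk => zD.
  by apply/bigcupP; exists z; rewrite !inE ?zD ?andbT // -?in_setC ?nbrI // Tsym.
- by apply: leq_trans (leq_imset_card _ _) (Ideg xI).
- have : (#|[set u in vertices D]| <= 2 * k)%N by rewrite -szv cardsE card_size.
  have -> : B = ~: [set u in vertices D] by apply/setP => u; rewrite !inE.
  have := cardsC [set u in vertices D]; move: Ularge kK; clear.
  by move: #|[set _ in _]| #|~: _| #|U| => *; lia.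
exists ((a, b) :: D); split; first by rewrite /= sD.
- rewrite !in_set in aB bB; have pE : perm_eq (vertices ((a, b) :: D)) (a :: b :: vertices D).
    by rewrite /vertices /= perm_cons perm_catC /= perm_cons perm_catC.
  by rewrite (perm_uniq pE) /= inE negb_or ab aB bB Du.
- move=> p; rewrite inE => /predU1P[->|/DX //] /=; exists x => // u ua ub.
  apply/forallP => z; apply/implyP => xz.
  have : f z \in [set a; b] by apply: (subsetP AB); apply: imset_f; rewrite inE.
  by rewrite !inE => /orP[] /eqP ->.
Qed.

(** Fewer than [m] vertices are missed by the [K] pairs, so some image of [Y1] is adjacent to both
    members of a pair. *)
Lemma fitting_pair f (X1 Y1 : {set V}) (F : V -> U) : partial_embedding f (~: I) ->
  injective F -> X1 \subset I -> (2 * K * Delta < #|X1|)%N -> (m <= #|Y1|)%N ->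
  exists x (y : V), [/\ x \in X1, y \in Y1 & fits f x (F y)].
Proof.
move=> pe FI XI Xl Yl.
have [D [sD Du DX]] := disjoint_pairs pe XI Xl (leqnn K).
have [_ /imsetP[y yY ->] yM] : exists2 w, w \in F @: Y1 & w \notin missed G D.
  apply/subsetPn/negP => /subset_leq_card; rewrite card_imset // leqNgt => /negP; apply.
  exact: leq_trans (few_missed sD Du) Yl.
move: yM; rewrite inE -has_predC => /hasP[p /DX[x xX H]] /=; rewrite negbK => /andP[h1 h2].
by exists x, y; split=> //; apply: H.
Qed.

Lemma extend_bijection f : {in ~: I &, injective f} -> exists F : {ffun V -> U},
  injective F /\ {in ~: I, F =1 f}.
Proof.
move=> fI; pose W := ~: (f @: ~: I).
have cW : #|W| = #|I|.
  have := cardsC (f @: ~: I); have := cardsC I; rewrite (card_in_imset fI) -/W => h1 h2.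
  by apply/eqP; rewrite -(eqn_add2l #|~: I|) h2 -cardVU -h1 addnC.
case: (set_0Vmem I) => [I0|[x0 x0I]].
  exists [ffun x => f x]; split=> [x y|x _]; rewrite !ffunE // => e.
  by apply: fI e; rewrite inE I0 inE.
have [u0 _] : exists u0, u0 \in W by apply/card_gt0P; rewrite cW; apply/card_gt0P; exists x0.
pose F := [ffun x => if x \in I then nth u0 (enum W) (index x (enum I)) else f x].
have idx x : x \in I -> (index x (enum I) < size (enum W))%N.
  by move=> xI; rewrite -cardE cW cardE index_mem mem_enum.
have FW x : x \in I -> F x \in W.
  by move=> xI; rewrite ffunE xI -mem_enum mem_nth // idx.
have Ff x : x \notin I -> F x = f x by move=> xI; rewrite ffunE (negbTE xI).
have nW x (y : V) : x \in I -> y \notin I -> F x <> f y.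
  move=> xI yI e; have := FW x xI; rewrite e inE => /negP; apply.
  by apply: imset_f; rewrite inE.
exists F; split=> [x y|x]; last by rewrite inE => /Ff.
case: (boolP (x \in I)) => xI; case: (boolP (y \in I)) => yI.
- rewrite !ffunE xI yI => /eqP; rewrite nth_uniq ?idx ?enum_uniq // => /eqP e.
  by rewrite -[x](nth_index x0 (s := enum I)) ?mem_enum // e nth_index ?mem_enum.
- by rewrite (Ff y yI) => /nW; case.
- by rewrite (Ff x xI) => /esym /nW; case.
- by rewrite !Ff //; apply: fI; rewrite inE.
Qed.

(* If [x0] is misplaced, many images are fit for [x0] and many vertices fit
   the image of [x0]; a pair of these that fit each other closes a 3-cycle. *)
Theorem spanning_embedding (u0 : U) : 0 < lam ->
  exists F : V -> U, injective F /\ forall x (y : V), T x y -> G (F x) (F y).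
Proof.
move=> lam_gt0; have [f pe] := partial_embedding_exists u0.
have [F0 [F0I F0f]] := extend_bijection (pe_inj pe).
pose ok (F : {ffun V -> U}) := injectiveb F && [forall z in ~: I, F z == f z].
pose good (F : {ffun V -> U}) := [set x in I | fits f x (F x)].
have ok0 : ok F0 by apply/andP; split; [apply/injectiveP|apply/forall_inP => z /F0f ->].
(* Among the bijections extending [f], one with the most well-placed vertices of [I]. *)
have [F /andP[/injectiveP FI /forall_inP Ff] Fmax] :
    exists2 F, ok F & forall F', ok F' -> (#|good F'| <= #|good F|)%N.
  by case: (arg_maxnP (fun F => #|good F|) ok0) => F; exists F.
have nbrI x z : x \in I -> T x z -> z \in ~: I.
  by move=> xI xz; rewrite inE; apply: contraL xz => zI; apply: Iind.
have allgood : {in I, forall x, fits f x (F x)}.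
  move=> x0 x0I; apply/negPn/negP => bad.
  pose X1 := [set x in I | fits f x0 (F x)].
  pose Y1 := [set x in I | fits f x (F x0)].
  have cY : (m <= #|Y1|)%N.
    apply: leq_trans (card_fits (F x0) lam_gt0 pe) _; apply: subset_leq_card.
    by apply/subsetP => x; rewrite !inE => /andP[/(subsetP I1I) -> ->].
  have cX : (2 * K * Delta < #|X1|)%N.
    have [||a [b [_ _ _ ab]]] := @extend_to_pair (f @: [set z | T x0 z]) setT (subsetT _).
    - by apply: leq_trans (leq_imset_card _ _) (Ideg x0I).
    - by rewrite cardsT; apply: leq_trans Ularge; rewrite addn2.
    have sub : [set x in S :\: f @: (~: I) | G x a && G x b] \subset F @: X1.
      apply/subsetP => y; rewrite inE => /and3P[/setDP[_ yf] ya yb].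
      have [x yE] : exists x, y = F x.
        have /imsetP[x _ ->] : y \in F @: setT; last by exists x.
        have /eqP -> : F @: setT == setT by rewrite eqEcard subsetT card_imset // !cardsT cardVU /=.
        by rewrite inE.
      rewrite yE in yf ya yb *; apply: imset_f; rewrite inE; apply/andP; split.
        apply/negPn/negP => xI; case/negP: yf; have xI' : x \in ~: I by rewrite inE.
        by rewrite (eqP (Ff x xI')); apply: imset_f.
      apply/forallP => z; apply/implyP => xz.
      have : f z \in [set a; b] by apply: (subsetP ab); apply: imset_f; rewrite inE.
      by rewrite !inE => /orP[] /eqP ->.
    have := subset_leq_card sub; rewrite card_imset // => h1.
    have := many_choices a b pe; move: h1 narrow I1pos; clear.
    by move: #|_| #|X1| #|I1| => *; lia.
  have XI : X1 \subset I by apply/subsetP => x; rewrite inE => /andP[].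
  have [x1 [x2 [x1X x2Y x12]]] := fitting_pair pe FI XI cX cY.
  move: x1X x2Y; rewrite !inE => /andP[x1I f1] /andP[x2I f2].
  have x10 : x1 != x0 by apply: contraNneq bad => e; rewrite e in f1.
  have x20 : x2 != x0 by apply: contraNneq bad => e; rewrite e in f2.
  (* The cycle [x0], [x1], [x2]; it becomes a transposition when [x1 = x2]. Composing [F] with it
     gives all three vertices fitting images. *)
  pose s x := tperm x1 x2 (tperm x0 x2 x).
  have s0 : s x0 = x1 by rewrite /s tpermL tpermR.
  have s2 : s x2 = x0 by rewrite /s tpermR tpermD // eq_sym.
  have s1 : x1 != x2 -> s x1 = x2.
    by move=> x1x2; rewrite /s [tperm x0 x2 x1]tpermD ?tpermL // eq_sym.
  have sD x : x != x0 -> x != x1 -> x != x2 -> s x = x.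
    by move=> *; rewrite /s !tpermD // eq_sym.
  pose F' := [ffun x => F (s x)].
  have okF' : ok F'.
    apply/andP; split.
      by apply/injectiveP => x y; rewrite !ffunE => /FI /perm_inj /perm_inj.
    apply/forall_inP => z zI; rewrite ffunE sD ?Ff //;
      by apply: contraTneq zI => ->; rewrite inE negbK.
  have := Fmax F' okF'; rewrite leqNgt => /negP; apply.
  apply: proper_card; apply/properP; split; last first.
    by exists x0; rewrite inE ?x0I /= ?ffunE ?s0.
  apply/subsetP => x; rewrite !inE => /andP[xI xF]; rewrite xI ffunE /=.
  case: (eqVneq x x0) => [->|xx0]; first by rewrite s0.
  case: (eqVneq x x2) => [->|xx2]; first by rewrite s2.
  case: (eqVneq x x1) => [xE|xx1]; last by rewrite sD.
  by rewrite xE s1 // -xE.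
have edgeI x (y : V) : x \in I -> T x y -> G (F x) (F y).
  move=> xI xy; rewrite (eqP (Ff y (nbrI x y xI xy))).
  by have /forallP/(_ y) := allgood x xI; rewrite xy.
exists F; split=> // x y xy.
case: (boolP (x \in I)) => xI; first exact: edgeI.
case: (boolP (y \in I)) => yI; first by rewrite Gsym edgeI // Tsym.
have [xI' yI'] : x \in ~: I /\ y \in ~: I by rewrite !inE.
rewrite (eqP (Ff x xI')) (eqP (Ff y yI')).
case: (rT.2 x y xy) => -[zr e]; rewrite -e in xI yI *.
  by have [_] := pe_edge pe xI' zr yI; rewrite Gsym.
by have [_] := pe_edge pe yI' zr xI.
Qed.

End Averaging.
End Embedding.

(** * Choice of the constants and conclusion *)

Lemma graph_of_sym (n : nat) (C : {set {set 'I_n}}) : symmetric (graph_of C).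
Proof. by move=> x y; rewrite /graph_of eq_sym setUC. Qed.

Lemma exists_subset_card (V : finType) (A : {set V}) (k : nat) : (k <= #|A|)%N ->
  exists2 B : {set V}, B \subset A & #|B| = k.
Proof.
rewrite cardE => kA; exists [set x in take k (enum A)].
  by apply/subsetP => x; rewrite inE => /mem_take; rewrite mem_enum.
rewrite cardsE (card_uniqP _) ?take_uniq ?enum_uniq // size_take.
by case: ltngtP kA.
Qed.

Lemma ln_ge1_eventually (R : realType) : exists N, forall n : nat,
  (N <= n)%N -> 1 <= ln (n%:R : R).
Proof.
exists (Num.bound (expR 1 : R)) => n Nn.
have e0 : 0 < expR 1 :> R by apply: expR_gt0.
have en : expR 1 <= n%:R :> R.
  by apply: le_trans (ltW (archi_boundP (ltW e0))) _; rewrite ler_nat.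
by rewrite -[leLHS]expRK ler_ln ?posrE // (lt_le_trans e0 en).
Qed.

(* Instantiated with [c = 2 * (129 * 129)] and [q = 64 * 64], which as closed
   unary numbers would be expensive. *)
Lemma parameters_fit (c q K Delta n i : nat) : (0 < c)%N -> (1024 <= q)%N ->
  (2 * q * c + 2 * q + 2 * K + 4096 <= n)%N ->
  (1024 * (4 * K * Delta) <= n)%N -> (n.-1 <= 4 * i)%N ->
  let m := (n %/ (2 * c * q)).+1 in
  [/\ c * m <= n %/ q, n %/ 16 + m <= i,
      2 * (2 * (n %/ q) + 2 * K * Delta) <= n %/ 16 %/ 12,
      0 < n %/ 16 %/ 12 /\ n %/ 16 <= 16 * (n %/ 16 %/ 12) &
      0 < n %/ q /\ n %/ q <= i]%N.
Proof.
move=> c0 q1 nl nK ni m.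
have q0 : (0 < q)%N by apply: leq_trans q1.
have nq1 : (n < q * (n %/ q).+1)%N by rewrite mulnC ltn_ceil.
have nq2 : (1024 * (n %/ q) <= n)%N.
  by apply: leq_trans (leq_trunc_div n q); rewrite mulnC leq_mul2l q1 orbT.
have mc : (2 * (q * (c * m)) <= n + 2 * (q * c))%N.
  have := leq_trunc_div n (2 * c * q); rewrite /m; move: (n %/ _)%N => t; clear; nia.
have m16 : (16 * m <= n %/ 64 + 16)%N.
  rewrite /m mulnS addnC leq_add2r leq_divRL //.
  apply: leq_trans (leq_trunc_div n (2 * c * q)).
  have cq : (1024 <= 2 * c * q)%N by apply: leq_trans q1 _; rewrite leq_pmull // muln_gt0 c0.
  by move: (n %/ _)%N => t; rewrite -mulnA mulnCA leq_mul2l; apply/orP; right; lia.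
have cm : (c * m <= n %/ q)%N.
  have : (q * (c * m) < q * (n %/ q).+1)%N.
    apply: leq_ltn_trans nq1; rewrite -(leq_pmul2l (isT : 0 < 2)%N).
    apply: leq_trans mc _; rewrite [leqRHS]mul2n -addnn leq_add2l (leq_trans _ nl) // mulnA.
    by rewrite -!addnA leq_addr.
  by rewrite ltn_pmul2l.
move: (n %/ q)%N nq1 nq2 cm => i1 nq1 nq2 cm.
have i1pos : (0 < i1)%N by apply: leq_trans cm; rewrite muln_gt0 c0.
split=> //; move: nl nK ni nq2 m16 i1pos; rewrite -?mulnA; clear.
- by move: (q * c)%N => *; lia.
- by move: (q * c)%N (K * Delta)%N => *; lia.
- by move: (q * c)%N => *; lia.
- by move: (q * c)%N => *; lia.
Qed.

Theorem theorem1p2 (R : realType) :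
  exists c : R, 0 < c /\
  exists N : nat, forall n : nat, (N <= n)%N ->
    waiter_forces (complete_edges n) (fun C : {set {set 'I_n}} =>
      forall (V : finType) (T : rel V),
        #|V| = n -> is_tree T ->
        (max_degree T)%:R <= c * n%:R / ln (n%:R : R) ->
        contains_copy (graph_of C) T).
Proof.
have [k kE] : exists k, k = (2 * (129 * 129))%N by exists (2 * (129 * 129))%N.
have [q qE] : exists q, q = (64 * 64)%N by exists (64 * 64)%N.
have k0 : (0 < k)%N by rewrite kE.
have q1 : (1024 <= q)%N by rewrite qE; lia.
have d0 : (0 < 2 * k * q)%N by rewrite !muln_gt0 k0 (leq_trans _ q1).
have [K [N1 [K0 HN1]]] := waiter_forces_quasirandom_large d0.
have [N2 HN2] := ln_ge1_eventually R.
(* The first summand pays for [log_small], the second for the bound on [K * Delta]. *)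
pose Q := (2 * k * q + 1024 * (4 * K))%N.
have Q0 : 0 < Q%:R :> R by rewrite ltr0n addn_gt0 d0.
exists Q%:R^-1; split; first by rewrite invr_gt0.
exists (N1 + N2 + (2 * q * k + 2 * q + 2 * K + 4096))%N => n nN.
have [nN1 nN2 nl] : [/\ N1 <= n, N2 <= n & 2 * q * k + 2 * q + 2 * K + 4096 <= n]%N.
  by split; apply: leq_trans nN; rewrite ?leq_addl // -addnA ?leq_addr // addnCA leq_addr.
apply: (waiter_forces_weaken _ (HN1 n nN1)) => C [codeg fewm] V T cV treeT degT.
have ln1 := HN2 n nN2; have [[Tsym _] _ _] := treeT.
have [root [par [dep rT]]] := tree_rooted treeT.
set Delta := max_degree T in degT.
have degD x : (#|[set y | T x y]| <= Delta)%N by apply: (leq_bigmax x).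
have degln : Q%:R * (Delta%:R * ln (n%:R : R)) <= n%:R :> R.
  by move: degT; rewrite ler_pdivlMr ?(lt_le_trans _ ln1) // ler_pdivlMl.
have Dln : Delta%:R <= Delta%:R * ln (n%:R : R) :> R by rewrite ler_peMr.
have KD : (1024 * (4 * K * Delta) <= n)%N.
  rewrite -(ler_nat R); apply: le_trans degln.
  apply: le_trans (_ : Q%:R * Delta%:R <= _); last by rewrite ler_pM2l.
  by rewrite -natrM ler_nat mulnA leq_mul2r leq_addl orbT.
have [I [Icard Ideg Iind]] := exists_independent rT.
rewrite cV in Icard.
have [h1 h2 h3 [h4 h5] [h6 h7]] := parameters_fit k0 q1 nl KD Icard.
have [I1 I1I I1card] := exists_subset_card h7.
have n2 : (1 < n)%N by apply: leq_trans nl; rewrite addnC.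
have Delta0 : (0 < Delta)%N.
  have [x [y [_ _ xy]]] : exists x y, [/\ x \in setT, y \in setT & x != y :> V].
    by apply/card_gt1P; rewrite cardsT cV.
  have [z zr] : exists z, z != root.
    by case: (eqVneq x root) xy => [->|xr] xy; [exists y; rewrite eq_sym|exists x].
  by apply: leq_trans (degD z); apply/card_gt0P; exists (par z); rewrite inE; case: (rT.1 z zr).
pose S := initial_part n (n %/ 16).
have Scard : #|S| = (n %/ 16)%N by rewrite card_initial_part // leq_div.
(* For [u = w], a common neighbour with any other vertex is a neighbour of [w]. *)
have codeg' (u w : 'I_n) :
    (n %/ 16 %/ 12 <= #|[set x in S | graph_of C x u && graph_of C x w]|)%N.
  case: (eqVneq u w) => [->|]; last exact: codeg.
  have [v vw] : exists v : 'I_n, v != w.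
    have /card_gt0P[v] : (0 < #|[set~ w]|)%N by rewrite cardsC1 card_ord; lia.
    by rewrite !inE; exists v.
  apply: leq_trans (codeg w v _) _; first by rewrite eq_sym.
  by apply: subset_leq_card; apply/subsetP => x; rewrite !inE => /and3P[-> ->].
set m := (n %/ (2 * k * q)).+1 in h1 h2.
have fewm' (D : seq ('I_n * 'I_n)) : size D = K -> uniq (vertices D) ->
    (#|missed (graph_of C) D| < m)%N.
  by move=> sD Du; rewrite /m ltnS leq_divRL //; apply: fewm.
(* This makes the left side of [lamM] equal to 128/129, while [lam * #|I1|] is still of order
   [n / Delta] and so exceeds [2 * ln n]. *)
pose lam : R := (129 * 129 * Delta%:R)^-1.
have D0 : 0 < Delta%:R :> R by rewrite ltr0n.
have lam0 : 0 < lam by rewrite invr_gt0 !mulr_gt0.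
have lamD : lam * (129 * 129 * Delta%:R) = 1 by rewrite mulVf // !mulf_neq0 ?gt_eqF.
have q0 : (0 < q)%N by apply: leq_trans q1.
have log_small : 2 * ln (n%:R : R) <= lam * (n %/ q)%:R.
  rewrite ler_pdivlMl ?mulr_gt0 //.
  have nq : n%:R <= 2 * q%:R * (n %/ q)%:R :> R.
    rewrite -!natrM ler_nat -mulnA mul2n -addnn.
    have := ltn_ceil n q0; rewrite mulSn mulnC => /ltnW/leq_trans; apply.
    by rewrite leq_add2r leq_pmulr.
  have Qk : 2 * k%:R * q%:R * (Delta%:R * ln (n%:R : R)) <= n%:R.
    apply: le_trans degln; apply: ler_wpM2r.
      by rewrite mulr_ge0 ?ler0n // (le_trans ler01).
    by rewrite -!natrM ler_nat leq_addr.
  have kR : k%:R = 2 * (129 * 129) :> R by rewrite kE !natrM.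
  have qR : 0 < q%:R :> R by rewrite ltr0n.
  rewrite -(ler_pM2l qR) -(ler_pM2l (ltr0n R 2)).
  have -> : 2 * (q%:R * (129 * 129 * Delta%:R * (2 * ln (n%:R : R)))) =
      2 * k%:R * q%:R * (Delta%:R * ln (n%:R : R)) by rewrite kR; ring.
  by apply: le_trans Qk _; rewrite mulrA.
have cardVU : #|V| = #|'I_n| by rewrite card_ord.
have lamM : 128 * (lam * (Delta%:R * 129)) <= 1.
  rewrite [Delta%:R * _]mulrC; move: lamD; rewrite -mulrA => lamD.
  have : 0 <= lam * (129 * Delta%:R) by rewrite !mulr_ge0 // ltW.
  by move: lamD; rewrite mulrCA; move: (lam * _) => z; lra.
have room : (#|S| + m <= #|I|)%N by rewrite Scard.
have narrow : (2 * (2 * #|I1| + 2 * K * Delta) <= n %/ 16 %/ 12)%N by rewrite I1card.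
have Ssmall : (#|S| <= 16 * (n %/ 16 %/ 12))%N by rewrite Scard.
have log_small' : 2 * ln (#|'I_n|%:R : R) <= lam * #|I1|%:R by rewrite card_ord I1card.
have I1large : (2 * (129 * 129) * m <= #|I1|)%N by rewrite -kE I1card.
have Ularge : (2 * K + 2 <= #|'I_n|)%N.
  by rewrite card_ord; move: nl; clear; move: (q * k)%N => *; lia.
have I1pos : (0 < #|I1|)%N by rewrite I1card.
by have [F [FI FG]] := spanning_embedding Tsym rT (@graph_of_sym n C) cardVU I1I Ideg Iind
    degD codeg' fewm' (ltW lam0) lamM K0 (ltn0Sn _) room narrow h4 Ssmall log_small' I1large
    Ularge I1pos (Ordinal (ltnW n2)) lam0; exists F.
Qed.
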